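(* Let $n\ge1$ and let $V$ be the rank-$n$ Heisenberg vertex operator algebra. Then for every $d\in\mathbb{N}$ there is an isomorphism of rings $$\mathsf{A}_d(V)\cong\prod_{m=0}^d\mathrm{Mat}_{p^n_m}(\mathsf{A}),\qquad \mathsf{A}=\mathbb{C}[h_1,\dots,h_n],$$ where $\mathsf{A}_d(V)$ is the level-$d$ Zhu algebra of $V$ and $p^n_m$ is the number of $n$-labeled partitions of $m$.
   Context: An $n$-labeled partition of $m$ is a sequence $(\sigma^1|\dots|\sigma^n)$ of $n$ (possibly empty) integer partitions with $\sum_i|\sigma^i|=m$, where $|\sigma^i|$ is the sum of the parts of $\sigma^i$; $p^n_0=1$. Heisenberg VOA: let $\mathfrak{h}$ be an abelian complex Lie algebra with basis $H_1,\dots,H_n$ and symmetric form $(H_i,H_j)=\delta_{ij}$, and $\widehat{\mathfrak{h}}=\mathfrak{h}\otimes\mathbb{C}[t,t^{-1}]\oplus\mathbb{C}\Bbbk$ with $\Bbbk$ central and $[Xf(t),Yg(t)]=(X,Y)\,\mathrm{res}(g\,df)\,\Bbbk$. The rank-$n$ Heisenberg (free boson) VOA $V$ is the vacuum module $U(\widehat{\mathfrak{h}})\otimes_{U(\mathfrak{h}\otimes\mathbb{C}[t]\oplus\mathbb{C}\Bbbk)}\mathbb{C}$ ($\mathfrak{h}\otimes\mathbb{C}[t]$ acting by $0$, $\Bbbk$ by $1$) with its standard VOA structure; it is the $n$-fold tensor product of the rank-1 Heisenberg VOA. $\mathsf{A}_d(V)$ is the level-$d$ Zhu algebra of Dong–Li–Mason.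 Equivalently, $\mathsf{A}_d(V)=\mathscr{U}_0/(\mathscr{U}\cdot\mathscr{U}_{\le-d-1})_0$, where $\mathscr{U}=\bigoplus_k\mathscr{U}_k$ is the graded universal enveloping algebra of $V$, which here is $\varprojlim_N U(\widehat{\mathfrak{h}})_{\Bbbk=1}/U(\widehat{\mathfrak{h}})_{\Bbbk=1}(\mathfrak{h}\otimes t^N\mathbb{C}[t])$, graded by $\deg(Xt^a)=-a$. *)

(* Defs.v *)
From HB Require Import structures.
From mathcomp Require Import all_boot all_order all_algebra.
From mathcomp Require Import generic_quotient ring_quotient.
From mathcomp Require Import boolp reals zify.
From mathcomp.real_closed Require Import complex.
From mathcomp.multinomials Require Import monalg mpoly.

Set Implicit Arguments.
Unset Strict Implicit.
Unset Printing Implicit Defensive.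

Import Order.TTheory GRing.Theory Num.Theory.

Local Open Scope ring_scope.
Local Open Scope quotient_scope.

Definition addspan (V : zmodType) (P : V -> Prop) (x : V) : Prop :=
  exists2 s : seq V, (forall y, y \in s -> P y) & x = \sum_(y <- s) y.

(* The product [A . B] of two subsets: all finite sums of products [a * b]. *)
Definition prodspan (R : pzRingType) (A B : R -> Prop) : R -> Prop :=
  addspan (fun x => exists a b, [/\ A a, B b & x = a * b]).

Section SpanTheory.
Variable V : zmodType.
Implicit Types (P Q : V -> Prop) (x y : V).

Lemma addspan0 P : addspan P 0.
Proof. by exists [::]; rewrite ?big_nil. Qed.

Lemma addspanD P x y : addspan P x -> addspan P y -> addspan P (x + y).
Proof.
case=> s Ps -> [t Pt ->]; exists (s ++ t); last by rewrite big_cat.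
by move=> z; rewrite mem_cat => /orP[/Ps|/Pt].
Qed.

Lemma addspan_gen P x : P x -> addspan P x.
Proof.
by move=> Px; exists [:: x] => [y|]; [rewrite inE => /eqP->|rewrite big_seq1].
Qed.

Lemma addspan_min P Q : Q 0 -> (forall x y, Q x -> Q y -> Q (x + y)) ->
  (forall x, P x -> Q x) -> forall x, addspan P x -> Q x.
Proof.
move=> Q0 QD PQ x [s Ps ->]; elim: s Ps => [|y s IHs] Ps; first by rewrite big_nil.
rewrite big_cons; apply: QD; first by apply/PQ/Ps; rewrite mem_head.
by apply: IHs => z zs; apply: Ps; rewrite inE zs orbT.
Qed.

Lemma addspan_sub P Q : (forall x, P x -> Q x) ->
  forall x, addspan P x -> addspan Q x.
Proof.
move=> PQ; apply: addspan_min => [|x y|x /PQ]; first exact: addspan0.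
  exact: addspanD.
exact: addspan_gen.
Qed.

Lemma addspanN P : (forall x, P x -> P (- x)) ->
  forall x, addspan P x -> addspan P (- x).
Proof.
move=> PN; apply: addspan_min => [|x y hx hy|x /PN]; last exact: addspan_gen.
  by rewrite oppr0; apply: addspan0.
by rewrite opprD; apply: addspanD.
Qed.

Lemma addspan_zmod P : (forall x, P x -> P (- x)) ->
  zmod_closed (fun x => `[< addspan P x >]).
Proof.
move=> PN; split; first by apply/asboolP/addspan0.
move=> x y /asboolP hx /asboolP hy; apply/asboolP.
by apply: addspanD => //; apply: addspanN.
Qed.

End SpanTheory.

Section ProdSpanTheory.
Variable R : pzRingType.
Implicit Types (A B C : R -> Prop) (x y : R).

Lemma prodspan_zmod A B : (forall x, A x -> A (- x)) ->
  zmod_closed (fun x => `[< prodspan A B x >]).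
Proof.
move=> AN; apply: addspan_zmod => x [a [b [Aa Bb ->]]].
by exists (- a), b; rewrite mulNr; split=> //; apply: AN.
Qed.

Lemma addspanM A B C : (forall x y, A x -> B y -> C (x * y)) ->
  forall x y, addspan A x -> addspan B y -> addspan C (x * y).
Proof.
move=> ABC x y hx hy; move: x hx; apply: addspan_min => [|u v hu hv|x Ax].
- by rewrite mul0r; apply: addspan0.
- by rewrite mulrDl; apply: addspanD.
move: y hy; apply: addspan_min => [|u v hu hv|y By].
- by rewrite mulr0; apply: addspan0.
- by rewrite mulrDr; apply: addspanD.
by apply/addspan_gen/ABC.
Qed.

Lemma prodspanMl A B C : (forall x a, C x -> A a -> A (x * a)) ->
  forall x y, C x -> prodspan A B y -> prodspan A B (x * y).
Proof.
move=> CA x y Cx; move: y; apply: addspan_min => [|u v hu hv|_ [a [b [Aa Bb ->]]]].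
- by rewrite mulr0; apply: addspan0.
- by rewrite mulrDr; apply: addspanD.
by apply: addspan_gen; exists (x * a), b; rewrite mulrA; split=> //; apply: CA.
Qed.

Lemma prodspanMr A B C : (forall b x, B b -> C x -> B (b * x)) ->
  forall y x, prodspan A B y -> C x -> prodspan A B (y * x).
Proof.
move=> BC y x hy Cx; move: y hy.
apply: addspan_min => [|u v hu hv|_ [a [b [Aa Bb ->]]]].
- by rewrite mul0r; apply: addspan0.
- by rewrite mulrDl; apply: addspanD.
by apply: addspan_gen; exists a, (b * x); rewrite mulrA; split=> //; apply: BC.
Qed.

End ProdSpanTheory.

(* The library only provides the ring structure for commutative rings. *)

HB.mixin Record isTwoSided (R : pzRingType) (S : R -> bool) := {
  twosided_mull : forall a x : R, S x -> S (a * x);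
  twosided_mulr : forall x a : R, S x -> S (x * a)
}.

#[short(type="twosided")]
HB.structure Definition TwoSided (R : pzRingType) :=
  {S of GRing.ZmodClosed R S & isTwoSided R S}.

Section TwoSidedQuotient.
Variables (R : pzRingType) (I : twosided R).

Definition tsquot : Type := Quotient.quot I.

HB.instance Definition _ := GRing.Zmodule.on tsquot.

Definition tspi : R -> tsquot := \pi_(Quotient.quot I).

Lemma tspi_eq (x y : R) : (tspi x == tspi y) = (x - y \in I).
Proof. by rewrite /tspi -Quotient.idealrBE. Qed.

Lemma tspiP (q : tsquot) : exists x, q = tspi x.
Proof. by exists (repr q); rewrite /tspi reprK. Qed.

Definition tsone : tsquot := tspi 1.
Definition tsmul (p q : tsquot) : tsquot := tspi (repr p * repr q).

Lemma tspiM x y : tspi (x * y) = tsmul (tspi x) (tspi y).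
Proof.
apply/eqP; rewrite tspi_eq.
set x' := repr _; set y' := repr _.
have hx : x - x' \in I.
  by rewrite -tspi_eq /tspi /x' reprK.
have hy : y - y' \in I.
  by rewrite -tspi_eq /tspi /y' reprK.
have -> : x * y - x' * y' = (x - x') * y + x' * (y - y').
  by rewrite mulrBl mulrBr addrA subrK.
by apply: rpredD; [apply: twosided_mulr|apply: twosided_mull].
Qed.

Lemma tspiD x y : tspi (x + y) = tspi x + tspi y.
Proof. by rewrite /tspi raddfD. Qed.

Lemma tsmulA : associative tsmul.
Proof.
move=> p q r; have [x ->] := tspiP p; have [y ->] := tspiP q.
by have [z ->] := tspiP r; rewrite -!tspiM mulrA.
Qed.

Lemma tsmul1 : left_id tsone tsmul.
Proof. by move=> p; have [x ->] := tspiP p; rewrite -tspiM mul1r. Qed.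

Lemma tsmulr1 : right_id tsone tsmul.
Proof. by move=> p; have [x ->] := tspiP p; rewrite -tspiM mulr1. Qed.

Lemma tsmulDl : left_distributive tsmul +%R.
Proof.
move=> p q r; have [x ->] := tspiP p; have [y ->] := tspiP q.
by have [z ->] := tspiP r; rewrite -tspiD -!tspiM -tspiD mulrDl.
Qed.

Lemma tsmulDr : right_distributive tsmul +%R.
Proof.
move=> p q r; have [x ->] := tspiP p; have [y ->] := tspiP q.
by have [z ->] := tspiP r; rewrite -tspiD -!tspiM -tspiD mulrDr.
Qed.

HB.instance Definition _ := GRing.Zmodule_isPzRing.Build tsquot
  tsmulA tsmul1 tsmulr1 tsmulDl tsmulDr.

Lemma tspi_is_zmod_morphism : zmod_morphism tspi.
Proof. by move=> x y; rewrite /tspi raddfB. Qed.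

Lemma tspi_is_monoid_morphism : monoid_morphism tspi.
Proof. by split=> // x y; rewrite tspiM. Qed.

HB.instance Definition _ :=
  GRing.isZmodMorphism.Build R tsquot tspi tspi_is_zmod_morphism.
HB.instance Definition _ :=
  GRing.isMonoidMorphism.Build R tsquot tspi tspi_is_monoid_morphism.

End TwoSidedQuotient.

Section GeneratedIdeal.
Variables (R : pzRingType) (rel : R -> Prop).

Definition tsgen (x : R) : bool :=
  `[< addspan (fun y => exists u r v, rel r /\ y = u * r * v) x >].

Lemma tsgen_zmod : zmod_closed tsgen.
Proof.
apply: addspan_zmod => _ [u [r [v [hr ->]]]].
by exists (- u), r, v; rewrite !mulNr.
Qed.

Lemma tsgen_mull a x : tsgen x -> tsgen (a * x).
Proof.
move=> /asboolP hx; apply/asboolP; move: x hx.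
apply: addspan_min => [|x y hx hy|_ [u [r [v [hr ->]]]]].
- by rewrite mulr0; apply: addspan0.
- by rewrite mulrDr; apply: addspanD.
by apply: addspan_gen; exists (a * u), r, v; rewrite !mulrA.
Qed.

Lemma tsgen_mulr x a : tsgen x -> tsgen (x * a).
Proof.
move=> /asboolP hx; apply/asboolP; move: x hx.
apply: addspan_min => [|x y hx hy|_ [u [r [v [hr ->]]]]].
- by rewrite mul0r; apply: addspan0.
- by rewrite mulrDl; apply: addspanD.
by apply: addspan_gen; exists u, r, (v * a); rewrite !mulrA.
Qed.

HB.instance Definition _ := GRing.isZmodClosed.Build R tsgen tsgen_zmod.
HB.instance Definition _ := isTwoSided.Build R tsgen tsgen_mull tsgen_mulr.

Definition presented : pzRingType := tsquot (TwoSided.clone R tsgen _).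
Definition presented_pi : {rmorphism R -> presented} :=
  @tspi R (TwoSided.clone R tsgen _).

Lemma presented_piP (q : presented) : exists x, q = presented_pi x.
Proof. exact: tspiP. Qed.

Lemma presented_rel r : rel r -> presented_pi r = 0.
Proof.
move=> hr; apply/eqP; rewrite -[X in _ == X](rmorph0 presented_pi).
rewrite tspi_eq subr0; apply/asboolP/addspan_gen.
by exists 1, r, 1; rewrite mul1r mulr1.
Qed.

End GeneratedIdeal.

(* [lfilt_cont] says that right multiplications are continuous for the linear
   topology with basis the [L N]; it is what makes the inverse limit of the
   left modules [W / L N] a ring. *)
Record lfilt (W : pzRingType) := LFilt {
  lfilt_pred :> nat -> zmodClosed W;
  lfilt_mull : forall N a x, x \in lfilt_pred N -> a * x \in lfilt_pred N;
  lfilt_dec : forall N x, x \in lfilt_pred N.+1 -> x \in lfilt_pred N;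
  lfilt_cont : forall N b, exists M, forall x,
    x \in lfilt_pred M -> x * b \in lfilt_pred N
}.

Section InverseLimit.
Variables (W : pzRingType) (L : lfilt W).

Definition lq (N : nat) : Type := Quotient.quot (L N).
HB.instance Definition _ N := GRing.Zmodule.on (lq N).

Definition lpi (N : nat) (w : W) : lq N := \pi_(Quotient.quot (L N)) w.
Definition lrep (N : nat) (q : lq N) : W := repr (q : Quotient.quot (L N)).

(* The projection [W / L N.+1 -> W / L N]. *)
Definition ltrans (N : nat) (q : lq N.+1) : lq N := lpi N (lrep q).

Record invlim := InvLim {
  comp :> forall N, lq N;
  comp_coh : forall N, ltrans (comp N.+1) = comp N
}.

HB.instance Definition _ := gen_eqMixin invlim.
HB.instance Definition _ := gen_choiceMixin invlim.

Lemma invlimP (x y : invlim) : (forall N, x N = y N) -> x = y.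
Proof.
case: x y => [x hx] [y hy] /= xy.
have e : x = y by apply: functional_extensionality_dep.
by case: _ / e in hy *; congr InvLim; apply: Prop_irrelevance.
Qed.

Lemma lrepK N : cancel (@lrep N) (@lpi N).
Proof. by move=> q; rewrite /lpi /lrep reprK. Qed.

Lemma lpi_eq N a b : (lpi N a == lpi N b) = (a - b \in L N).
Proof. by rewrite /lpi -Quotient.idealrBE. Qed.

Lemma lpiB N : {morph lpi N : a b / a - b}.
Proof. by move=> a b; rewrite /lpi raddfB. Qed.

Lemma lpiD N : {morph lpi N : a b / a + b}.
Proof. by move=> a b; rewrite /lpi raddfD. Qed.

Lemma lpiN N : {morph lpi N : a / - a}.
Proof. by move=> a; rewrite /lpi raddfN. Qed.

Lemma lpi0 N : lpi N 0 = 0.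
Proof. by rewrite /lpi raddf0. Qed.

Lemma lfilt_le M N x : (M <= N)%N -> x \in L N -> x \in L M.
Proof.
move=> leMN; rewrite -(subnK leMN); elim: (N - M)%N => // k IHk.
by move/lfilt_dec/IHk.
Qed.

Lemma ltransE N w : ltrans (lpi N.+1 w) = lpi N w.
Proof.
apply/eqP; rewrite /ltrans lpi_eq; apply: lfilt_dec.
by rewrite -lpi_eq lrepK.
Qed.

Lemma comp_le (x : invlim) M N w : (M <= N)%N -> x N = lpi N w -> x M = lpi M w.
Proof.
move=> leMN; rewrite -(subnK leMN); elim: (N - M)%N => // k IHk hk.
by apply: IHk; rewrite -comp_coh hk ltransE.
Qed.

Lemma invlim_rep (x : invlim) N : exists w, x N = lpi N w.
Proof. by exists (lrep (x N)); rewrite lrepK. Qed.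

Definition limC (w : W) : invlim :=
  @InvLim (fun N => lpi N w) (fun N => ltransE N w).

Lemma lim_add_coh (x y : invlim) N : ltrans (x N.+1 + y N.+1) = x N + y N.
Proof.
have [a xa] := invlim_rep x N.+1; have [b yb] := invlim_rep y N.+1.
rewrite -(comp_coh x N) -(comp_coh y N) xa yb -lpiD !ltransE.
by rewrite lpiD.
Qed.
Definition lim_add x y := InvLim (lim_add_coh x y).

Lemma lim_opp_coh (x : invlim) N : ltrans (- x N.+1) = - x N.
Proof.
have [a xa] := invlim_rep x N.+1.
by rewrite -(comp_coh x N) xa -lpiN !ltransE lpiN.
Qed.
Definition lim_opp x := InvLim (lim_opp_coh x).

Lemma lim_addA : associative lim_add.
Proof. by move=> x y z; apply: invlimP => N /=; rewrite addrA. Qed.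
Lemma lim_addC : commutative lim_add.
Proof. by move=> x y; apply: invlimP => N /=; rewrite addrC. Qed.
Lemma lim_add0 : left_id (limC 0) lim_add.
Proof. by move=> x; apply: invlimP => N /=; rewrite lpi0 add0r. Qed.
Lemma lim_addN : left_inverse (limC 0) lim_opp lim_add.
Proof. by move=> x; apply: invlimP => N /=; rewrite lpi0 addNr. Qed.

HB.instance Definition _ :=
  GRing.isZmodule.Build invlim lim_addA lim_addC lim_add0 lim_addN.

(* The [N]-th component of [x * y] is the class of [a * b], where [b] represents
   the [N]-th component of [y] and [a] the [M]-th component of [x] for any [M]
   such that [L M * b] is contained in [L N]; see [lim_mul_seqE]. *)
Definition modulus (N : nat) (b : W) : nat := projT1 (cid (lfilt_cont L N b)).

Definition lim_mul_seq (x y : invlim) (N : nat) : lq N :=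
  let b := lrep (y N) in lpi N (lrep (x (modulus N b)) * b).

Definition good M N b := forall z, z \in L M -> z * b \in L N.

Lemma good_le M M' N N' b : (M <= M')%N -> (N' <= N)%N ->
  good M N b -> good M' N' b.
Proof. by move=> leM leN g z /(lfilt_le leM)/g; apply: lfilt_le. Qed.

Lemma lim_mul_seqE (x y : invlim) M N a b :
  x M = lpi M a -> y N = lpi N b -> good M N b ->
  lim_mul_seq x y N = lpi N (a * b).
Proof.
move=> xa yb gb; rewrite /lim_mul_seq /=; set b0 := lrep (y N).
set M0 := modulus N b0; set a0 := lrep (x M0).
have gb0 : good M0 N b0 by rewrite /M0 /modulus; case: cid.
have [c xc] := invlim_rep x (maxn M M0).
have ca : c - a \in L M.
  by rewrite -lpi_eq -xa; apply/eqP/esym/(comp_le _ xc)/leq_maxl.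
have a0c : a0 - c \in L M0.
  by rewrite -lpi_eq /a0 lrepK; apply/eqP/(comp_le _ xc)/leq_maxr.
have b0b : b0 - b \in L N by rewrite -lpi_eq /b0 lrepK yb.
apply/eqP; rewrite lpi_eq.
have -> : a0 * b0 - a * b = (a0 - c) * b0 + (c * (b0 - b) + (c - a) * b).
  by rewrite !mulrBl mulrBr !addrA !subrK.
by rewrite rpredD ?gb0 // rpredD ?gb // lfilt_mull.
Qed.

Lemma good_ex N b : exists M, good M N b.
Proof. exact: lfilt_cont. Qed.

Lemma lim_mul_coh (x y : invlim) N : ltrans (lim_mul_seq x y N.+1) = lim_mul_seq x y N.
Proof.
have [b yb] := invlim_rep y N.+1; have [M gb] := good_ex N.+1 b.
have [a xa] := invlim_rep x M.
rewrite (lim_mul_seqE xa yb gb) ltransE; apply/esym/(lim_mul_seqE xa).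
  exact: comp_le (leqnSn N) yb.
exact: good_le (leqnn M) (leqnSn N) gb.
Qed.

Definition lim_mul x y := InvLim (lim_mul_coh x y).

Lemma lim_mulA : associative lim_mul.
Proof.
move=> x y z; apply: invlimP => N.
have [c zc] := invlim_rep z N; have [M gc] := good_ex N c.
have [b yb] := invlim_rep y M; have [K1 gb] := good_ex M b.
have [K2 gbc] := good_ex N (b * c); set K := maxn K1 K2.
have gbK : good K M b by apply: good_le gb; rewrite ?leq_maxl.
have gbcK : good K N (b * c) by apply: good_le gbc; rewrite ?leq_maxr.
have [a xa] := invlim_rep x K.
have yz : lim_mul y z N = lpi N (b * c) by apply: lim_mul_seqE gc.
have xy : lim_mul x y M = lpi M (a * b) by apply: lim_mul_seqE gbK.
rewrite [LHS](lim_mul_seqE xa yz gbcK) [RHS](lim_mul_seqE xy zc gc).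
by rewrite mulrA.
Qed.

Lemma lim_mul1 : left_id (limC 1) lim_mul.
Proof.
move=> x; apply: invlimP => N; have [b xb] := invlim_rep x N.
have [M gb] := good_ex N b.
by rewrite [LHS](@lim_mul_seqE _ _ M N 1 b) // mul1r.
Qed.

Lemma lim_mulr1 : right_id (limC 1) lim_mul.
Proof.
move=> x; apply: invlimP => N; have [a xa] := invlim_rep x N.
by rewrite [LHS](@lim_mul_seqE _ _ N N a 1) ?mulr1 // => z; rewrite mulr1.
Qed.

Lemma lim_mulDl : left_distributive lim_mul +%R.
Proof.
move=> x y z; apply: invlimP => N; have [c zc] := invlim_rep z N.
have [M gc] := good_ex N c.
have [a xa] := invlim_rep x M; have [b yb] := invlim_rep y M.
have xy : (x + y) M = lpi M (a + b) by rewrite lpiD -xa -yb.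
rewrite [LHS](lim_mul_seqE xy zc gc).
rewrite [RHS](_ : _ = lim_mul_seq x z N + lim_mul_seq y z N) //.
by rewrite (lim_mul_seqE xa zc gc) (lim_mul_seqE yb zc gc) mulrDl lpiD.
Qed.

Lemma lim_mulDr : right_distributive lim_mul +%R.
Proof.
move=> x y z; apply: invlimP => N.
have [b yb] := invlim_rep y N; have [c zc] := invlim_rep z N.
have [M1 gb1] := good_ex N b; have [M2 gc2] := good_ex N c.
set M := maxn M1 M2.
have gb : good M N b by apply: good_le gb1; rewrite ?leq_maxl.
have gc : good M N c by apply: good_le gc2; rewrite ?leq_maxr.
have gbc : good M N (b + c) by move=> u hu; rewrite mulrDr rpredD ?gb ?gc.
have [a xa] := invlim_rep x M.
have yz : (y + z) N = lpi N (b + c) by rewrite lpiD -yb -zc.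
rewrite [LHS](lim_mul_seqE xa yz gbc).
rewrite [RHS](_ : _ = lim_mul_seq x y N + lim_mul_seq x z N) //.
by rewrite (lim_mul_seqE xa yb gb) (lim_mul_seqE xa zc gc) mulrDr lpiD.
Qed.

HB.instance Definition _ := GRing.Zmodule_isPzRing.Build invlim
  lim_mulA lim_mul1 lim_mulr1 lim_mulDl lim_mulDr.

End InverseLimit.

Record grading (W : pzRingType) := Grading {
  gr_deg :> int -> W -> Prop;
  gr_deg0 : forall k, gr_deg k 0;
  gr_degD : forall k x y, gr_deg k x -> gr_deg k y -> gr_deg k (x + y);
  gr_degN : forall k x, gr_deg k x -> gr_deg k (- x);
  gr_deg1 : gr_deg 0 1;
  gr_degM : forall j k x y, gr_deg j x -> gr_deg k y -> gr_deg (j + k) (x * y)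
}.

Section GradedCompletion.
Variables (W : pzRingType) (L : lfilt W) (G : grading W).

(* The component [U_k] of degree [k] of the completion: the inverse limit over
   [N] of the images of the degree [k] part of [W] in [W / L N]. *)
Definition U_deg (k : int) (x : invlim L) : Prop :=
  forall N, exists2 w, G k w & x N = lpi L N w.

(* The graded ring [U = \bigoplus_k U_k], as a subset of the full completion,
   and its subset [U_(<= m) = \bigoplus_(k <= m) U_k]. *)
Definition U_gr : invlim L -> Prop := addspan (fun x => exists k, U_deg k x).
Definition U_le (m : int) : invlim L -> Prop :=
  addspan (fun x => exists2 k, k <= m & U_deg k x).

Lemma U_degD k x y : U_deg k x -> U_deg k y -> U_deg k (x + y).
Proof.
move=> hx hy N; have [a da xa] := hx N; have [b db yb] := hy N.
by exists (a + b); [exact: gr_degD|rewrite lpiD -xa -yb].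
Qed.

Lemma U_degN k x : U_deg k x -> U_deg k (- x).
Proof.
move=> hx N; have [a da xa] := hx N.
by exists (- a); [exact: gr_degN|rewrite lpiN -xa].
Qed.

Lemma U_degM j k x y : U_deg j x -> U_deg k y -> U_deg (j + k) (x * y).
Proof.
move=> hx hy N; have [b db yb] := hy N.
have [M gb] := good_ex L N b; have [a da xa] := hx M.
by exists (a * b); [exact: gr_degM|exact: lim_mul_seqE xa yb gb].
Qed.

Lemma U_deg1 : U_deg 0 1.
Proof. by move=> N; exists 1; [exact: gr_deg1|]. Qed.

Lemma U_grN x : U_gr x -> U_gr (- x).
Proof. by apply: addspanN => y [k hy]; exists k; apply: U_degN. Qed.

Lemma U_grM x y : U_gr x -> U_gr y -> U_gr (x * y).
Proof. by apply: addspanM => a b [j ha] [k hb]; exists (j + k); apply: U_degM. Qed.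

Lemma U_leM m x y : U_le m x -> U_deg 0 y -> U_le m (x * y).
Proof.
move=> hx hy; apply: (addspanM (B := U_deg 0)) hx (addspan_gen hy).
by move=> a b [k lekm ha] hb; exists k => //; rewrite -[k]addr0; apply: U_degM.
Qed.

Definition U0_pred (x : invlim L) : bool := `[< U_deg 0 x >].

Lemma U0_pred_subring : subring_closed U0_pred.
Proof.
split=> [|x y /asboolP hx /asboolP hy|x y /asboolP hx /asboolP hy].
- exact/asboolP/U_deg1.
- by apply/asboolP/U_degD => //; apply: U_degN.
by apply/asboolP; rewrite -[0]addr0; apply: U_degM.
Qed.

HB.instance Definition _ :=
  GRing.isSubringClosed.Build (invlim L) U0_pred U0_pred_subring.

Record U0 : Type := MkU0 { U0_val : invlim L; U0_valP : U0_pred U0_val }.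
HB.instance Definition _ := [isSub for U0_val].
HB.instance Definition _ := [Choice of U0 by <:].
HB.instance Definition _ :=
  GRing.SubChoice_isSubPzRing.Build (invlim L) U0_pred U0 U0_pred_subring.

(* [(U . U_(<= - d - 1))_0], as an ideal of [U_0]; the sums of products are finite,
   no closure is taken. *)
Definition level_ideal (d : nat) (x : U0) : bool :=
  `[< prodspan U_gr (U_le (- d%:Z - 1)) (U0_val x) >].

Lemma level_ideal_zmod d : zmod_closed (level_ideal d).
Proof.
have [h0 hB] := prodspan_zmod (U_le (- d%:Z - 1)) U_grN.
by split=> [|x y hx hy]; [exact: h0|exact: hB hx hy].
Qed.

Lemma level_ideal_mull d a x : level_ideal d x -> level_ideal d (a * x).
Proof.
move=> /asboolP hx; apply/asboolP; apply: (prodspanMl U_grM) hx.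
by apply: addspan_gen; exists 0; case: a => a /= /asboolP.
Qed.

Lemma level_ideal_mulr d x a : level_ideal d x -> level_ideal d (x * a).
Proof.
move=> /asboolP hx; apply/asboolP; apply: (prodspanMr (@U_leM _)) hx _.
by case: a => a /= /asboolP.
Qed.

HB.instance Definition _ d :=
  GRing.isZmodClosed.Build U0 (level_ideal d) (level_ideal_zmod d).
HB.instance Definition _ d := isTwoSided.Build U0 (level_ideal d)
  (@level_ideal_mull d) (@level_ideal_mulr d).

Definition level_quot (d : nat) : pzRingType :=
  tsquot (TwoSided.clone U0 (level_ideal d) _).

End GradedCompletion.

(* [W] is spanned by scalar multiples [mon c w] of words [w] in modes; the label
   [(i, a)] stands for [H_i t^a], of degree [- a]. *)
Section Modes.
Variables (K : pzRingType) (I : choiceType) (W : pzRingType).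
Local Notation word := {fmonom (I * int)%type}.
Variable mon : K -> word -> W.

Definition mode (i : I) (a : int) : W := mon 1 (fmu (i, a)).

Definition word_deg (w : word) : int :=
  \sum_(g <- (w : seq (I * int)%type)) - g.2.

Definition mode_deg (k : int) : W -> Prop :=
  addspan (fun x => exists c w, word_deg w = k /\ x = mon c w).

(* [W . (h \otimes t^N C[t])]. *)
Definition mode_left (N : nat) (x : W) : bool :=
  `[< prodspan (fun=> True)
        (fun y => exists i a, (N%:Z <= a) /\ y = mode i a) x >].

Lemma mode_left_zmod N : zmod_closed (mode_left N).
Proof. exact: prodspan_zmod. Qed.

HB.instance Definition _ N :=
  GRing.isZmodClosed.Build W (mode_left N) (mode_left_zmod N).

Lemma mode_left_mull N a x : x \in mode_left N -> a * x \in mode_left N.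
Proof.
by move=> /asboolP hx; apply/asboolP; apply: (@prodspanMl _ _ _ (fun=> True)).
Qed.

Lemma mode_left_le N M x : (N <= M)%N -> x \in mode_left M -> x \in mode_left N.
Proof.
move=> leNM /asboolP hx; apply/asboolP; move: x hx; apply: addspan_sub.
move=> _ [u [_ [_ [i [a [leMa ->]]] ->]]].
exists u, (mode i a); split=> //; exists i, a; split=> //.
by apply: le_trans leMa; rewrite lez_nat.
Qed.

Lemma mode_left_dec N x : x \in mode_left N.+1 -> x \in mode_left N.
Proof. exact: mode_left_le. Qed.

Lemma mode_left_gen N i (a : int) : N%:Z <= a -> mode i a \in mode_left N.
Proof.
move=> leNa; apply/asboolP/addspan_gen; exists 1, (mode i a).
by rewrite mul1r; split=> //; exists i, a.
Qed.

Hypothesis mon1 : mon 1 mone = 1.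
Hypothesis monM : forall c d v w, mon c v * mon d w = mon (c * d) (mmul v w).
Hypothesis monN : forall c w, - mon c w = mon (- c) w.
Hypothesis mon_span : forall x, addspan (fun y => exists c w, y = mon c w) x.
Hypothesis mode_comm : forall i j a b, a + b != 0 ->
  mode i a * mode j b = mode j b * mode i a.

Definition cont (b : W) : Prop := forall N : nat, exists M, forall x,
  x \in mode_left M -> x * b \in mode_left N.

Lemma cont0 : cont 0.
Proof. by move=> N; exists 0%N => x _; rewrite mulr0 rpred0. Qed.

Lemma contD b c : cont b -> cont c -> cont (b + c).
Proof.
move=> hb hc N; have [M1 h1] := hb N; have [M2 h2] := hc N.
exists (maxn M1 M2) => x hx; rewrite mulrDr rpredD //.
  by apply: h1; apply: mode_left_le hx; apply: leq_maxl.
by apply: h2; apply: mode_left_le hx; apply: leq_maxr.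
Qed.

Lemma contM b c : cont b -> cont c -> cont (b * c).
Proof.
move=> hb hc N; have [M h] := hc N; have [k hk] := hb M.
by exists k => x /hk/h; rewrite mulrA.
Qed.

Lemma cont_gen b N M :
  (forall i (a : int), M%:Z <= a -> mode i a * b \in mode_left N) ->
  forall x, x \in mode_left M -> x * b \in mode_left N.
Proof.
move=> h x /asboolP; move: x; apply: addspan_min => [|x y hx hy|].
- by rewrite mul0r rpred0.
- by rewrite mulrDl rpredD.
by move=> _ [u [_ [_ [i [a [leMa ->]]] ->]]]; rewrite -mulrA mode_left_mull ?h.
Qed.

Lemma cont_mode j b : cont (mode j b).
Proof.
move=> N; exists (maxn N `|b|%N.+1); apply: cont_gen => i a leMa.
rewrite mode_comm; last by apply/eqP; lia.
by apply/mode_left_mull/mode_left_gen; lia.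
Qed.

Lemma cont_word c w : cont (mon c w).
Proof.
rewrite -[w]fmK; elim: (fmonom_val w) => [|[j b] s IHs].
  move=> N; exists N; apply: cont_gen => i a leNa.
  suff -> : mode i a * mon c (FMonom [::]) = mon c (FMonom [::]) * mode i a.
    by apply: mode_left_mull; apply: mode_left_gen.
  rewrite /mode !monM mulr1 mul1r.
  by congr mon; apply: val_inj; rewrite /= !fmM cats0.
have -> : mon c (FMonom ((j, b) :: s)) = mode j b * mon c (FMonom s).
  by rewrite /mode monM mul1r; congr mon; apply: val_inj; rewrite /= fmM fmU.
by apply: contM => //; apply: cont_mode.
Qed.

Lemma contT N b : exists M, forall x,
  x \in mode_left M -> x * b \in mode_left N.
Proof.
suff : cont b by [].
move: b (mon_span b); apply: addspan_min => [|x y|_ [c [w ->]]].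
- exact: cont0.
- exact: contD.
exact: cont_word.
Qed.

Definition mode_filt : lfilt W :=
  @LFilt W (fun N => GRing.ZmodClosed.clone W (mode_left N) _)
    mode_left_mull mode_left_dec contT.

Lemma mode_degN k x : mode_deg k x -> mode_deg k (- x).
Proof.
by apply: addspanN => _ [c [w [ew ->]]]; exists (- c), w; rewrite monN.
Qed.

Lemma mode_deg1 : mode_deg 0 1.
Proof.
apply: addspan_gen; exists 1, mone; split; last by rewrite mon1.
by rewrite /word_deg fm1 big_nil.
Qed.

Lemma mode_degM j k x y :
  mode_deg j x -> mode_deg k y -> mode_deg (j + k) (x * y).
Proof.
apply: addspanM => _ _ [c [v [<- ->]]] [c' [w [<- ->]]].
exists (c * c'), (mmul v w); rewrite monM; split=> //.
by rewrite /word_deg fmM big_cat.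
Qed.

Definition mode_grading : grading W :=
  @Grading W mode_deg (fun=> addspan0 _) (fun k => @addspanD _ _)
    mode_degN mode_deg1 mode_degM.

End Modes.

Section Heisenberg.
Variables (R : realType) (n : nat).
Local Notation C := R[i].

Definition hfree : pzRingType := {malg C[{fmonom ('I_n * int)%type}]}.

Definition hmon (c : C) (w : {fmonom ('I_n * int)%type}) : hfree := mkmalgU w c.

Definition hgen (i : 'I_n) (a : int) : hfree := mode hmon i a.

(* [H_i t^a, H_j t^b] = (H_i, H_j) res(t^b d(t^a)) k = a delta_ij delta_(a+b,0) k,
   with k set to 1. *)
Definition heis_rel (x : hfree) : Prop :=
  exists i j a b, x = hgen i a * hgen j b - hgen j b * hgen i a
                      - (a *+ ((i == j) && (a + b == 0)))%:~R.

(* The enveloping algebra of the affine Heisenberg Lie algebra at k = 1. *)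
Definition Uheis : pzRingType := presented heis_rel.
Definition Upi : {rmorphism hfree -> Uheis} := presented_pi heis_rel.

Definition Umon (c : C) (w : {fmonom ('I_n * int)%type}) : Uheis := Upi (hmon c w).

Lemma Umon1 : Umon 1 mone = 1.
Proof. exact: (rmorph1 Upi). Qed.

Lemma UmonM c d v w : Umon c v * Umon d w = Umon (c * d) (mmul v w).
Proof.
rewrite /Umon -(rmorphM Upi); congr (Upi _); exact: fgmulUU.
Qed.

Lemma UmonN c w : - Umon c w = Umon (- c) w.
Proof.
rewrite /Umon -(rmorphN Upi); congr (Upi _); apply/esym; exact: monalgUN.
Qed.

Lemma Umon_span x : addspan (fun y => exists c w, y = Umon c w) x.
Proof.
have [y ->] : exists y, x = Upi y by exact: presented_piP.
rewrite (monalgE (y : {malg C[{fmonom ('I_n * int)%type}]})).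
rewrite (big_morph Upi (rmorphD Upi) (rmorph0 Upi)).
apply: big_ind => [|u v|k _]; [exact: addspan0|exact: addspanD|].
by apply: addspan_gen; exists (monalg.mcoeff k (y : {malg C[{fmonom ('I_n * int)%type}]})), k.
Qed.

Lemma Umode_comm i j a b : a + b != 0 ->
  mode Umon i a * mode Umon j b = mode Umon j b * mode Umon i a.
Proof.
move=> /negPf ab0; apply/eqP; rewrite -subr_eq0.
suff /presented_rel h : heis_rel (hgen i a * hgen j b - hgen j b * hgen i a).
  by rewrite -(rmorphM Upi) -(rmorphM Upi) -(rmorphB Upi); apply/eqP.
by exists i, j, a, b; rewrite ab0 andbF mulr0n subr0.
Qed.

Definition heis_filt : lfilt Uheis := mode_filt UmonM Umon_span Umode_comm.

Definition heis_grading : grading Uheis := mode_grading Umon1 UmonM UmonN.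

(* The level [d] Zhu algebra of the rank [n] Heisenberg vertex operator algebra,
   whose graded universal enveloping algebra is the graded completion of
   [Uheis] along [heis_filt]. *)
Definition zhu (d : nat) : pzRingType := level_quot heis_filt heis_grading d.

End Heisenberg.

(* Parts are listed in weakly decreasing order; the empty partition is allowed. *)
Definition is_part (s : seq nat) : bool := sorted geq s && (0%N \notin s).

(* The bounds (at most [m] parts, each at most [m]) hold automatically for
   partitions of integers at most [m]; they only serve to get a finite type. *)
Definition labeled_partitions (n m : nat) :
    {set n.-tuple (m.-bseq 'I_m.+1)} :=
  [set t : n.-tuple (m.-bseq 'I_m.+1) |
    all (fun s : m.-bseq 'I_m.+1 => is_part (map val s)) t &&
    (\sum_(s <- t) sumn (map val s) == m)%N].

Definition num_labeled_partitions (n m : nat) : nat := #|labeled_partitions n m|.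

Section ProductRing.
Variables (I : Type) (S : I -> pzRingType).

Definition prod_ring : Type := forall i, S i.
HB.instance Definition _ := Choice.on prod_ring.

Implicit Types f g h : prod_ring.

Local Notation ext := functional_extensionality_dep.

Definition prod_ring0 : prod_ring := fun=> 0.
Definition prod_ring1 : prod_ring := fun=> 1.
Definition prod_ring_opp f : prod_ring := fun i => - f i.
Definition prod_ring_add f g : prod_ring := fun i => f i + g i.
Definition prod_ring_mul f g : prod_ring := fun i => f i * g i.

Lemma prod_ring_addA : associative prod_ring_add.
Proof. by move=> f g h; apply: ext => i; apply: addrA. Qed.
Lemma prod_ring_addC : commutative prod_ring_add.
Proof. by move=> f g; apply: ext => i; apply: addrC. Qed.
Lemma prod_ring_add0 : left_id prod_ring0 prod_ring_add.
Proof. by move=> f; apply: ext => i; apply: add0r. Qed.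
Lemma prod_ring_addN : left_inverse prod_ring0 prod_ring_opp prod_ring_add.
Proof. by move=> f; apply: ext => i; apply: addNr. Qed.

HB.instance Definition _ := GRing.isZmodule.Build prod_ring
  prod_ring_addA prod_ring_addC prod_ring_add0 prod_ring_addN.

Lemma prod_ring_mulA : associative prod_ring_mul.
Proof. by move=> f g h; apply: ext => i; apply: mulrA. Qed.
Lemma prod_ring_mul1 : left_id prod_ring1 prod_ring_mul.
Proof. by move=> f; apply: ext => i; apply: mul1r. Qed.
Lemma prod_ring_mulr1 : right_id prod_ring1 prod_ring_mul.
Proof. by move=> f; apply: ext => i; apply: mulr1. Qed.
Lemma prod_ring_mulDl : left_distributive prod_ring_mul +%R.
Proof. by move=> f g h; apply: ext => i; apply: mulrDl. Qed.
Lemma prod_ring_mulDr : right_distributive prod_ring_mul +%R.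
Proof. by move=> f g h; apply: ext => i; apply: mulrDr. Qed.

HB.instance Definition _ := GRing.Zmodule_isPzRing.Build prod_ring
  prod_ring_mulA prod_ring_mul1 prod_ring_mulr1 prod_ring_mulDl prod_ring_mulDr.

End ProductRing.

(* Main.v *)
(* The enveloping algebra acts on the universal Fock module, the polynomials in the
   creation operators over A = C[h_1, ..., h_n]; its part of degree m is free over A
   with basis the labeled partitions of m, and elements of degree 0 act on it by
   matrices over A. This gives the map, since an element of U_(<= - d - 1) kills the
   parts of degree at most d. By normal ordering, an element of degree 0 is a sum of
   terms u p v, with v an annihilation monomial of degree - m and u a creation
   monomial of degree m; such a term kills the parts of degree < m and acts as a
   multiple of a matrix unit on that of degree m. So the action is triangular, which
   gives surjectivity and reduces the kernel to the sums of terms with m > d.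

   As no closure is taken in the ideal, infinite sums of such terms have to be
   written as finite sums of products. With k = d + 1 and
     D = \sum_(i, j >= 1) j^-1 (H_i t^(- k - j)) (H_i t^j),
   one has [D, H_i t^(- b)] = H_i t^(- b - k) for b >= 1. Hence D and the finitely many
   creation monomials with parts < 2 k, at most k factors and degree >= k generate a
   right ideal that contains all creation monomials of degree >= k, and their
   coefficients can be summed over infinitely many terms. *)

Require Import Defs.
From HB Require Import structures.
From mathcomp Require Import all_boot all_order all_algebra.
From mathcomp Require Import generic_quotient.
From mathcomp Require Import boolp reals zify finmap.
From mathcomp.real_closed Require Import complex.
(* [monalg] is only imported in sections: it overrides the notation [{mpoly R[n]}]. *)
From mathcomp.multinomials Require monalg.
From mathcomp.multinomials Require Import mpoly.

Set Implicit Arguments.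
Unset Strict Implicit.
Unset Printing Implicit Defensive.

Import Order.TTheory GRing.Theory Num.Theory.

Local Open Scope ring_scope.

(** * The Fock module *)

Section FockSpace.
Variables (X : eqType) (A : comNzRingType).

(** No finiteness is imposed on the support here; it comes from [fock_deg], which also cuts out the
    graded parts. *)
Definition fock : Type := (X -> nat) -> A.

Record fock_end := FockEnd {
  fock_fun :> fock -> fock;
  fock_funP : forall p f g, fock_fun (fun b => p * f b + g b) =
                            (fun b => p * fock_fun f b + fock_fun g b)
}.

HB.instance Definition _ := gen_eqMixin fock_end.
HB.instance Definition _ := gen_choiceMixin fock_end.

Implicit Types (f g : fock) (b : X -> nat) (e : X) (S T : fock_end).

Lemma fock_endP S T : (forall f b, S f b = T f b) -> S = T.
Proof.
case: S T => [S hS] [T hT] /= ST.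
have e : S = T by apply: funext => f; apply: funext => b.
by case: _ / e in hT *; congr FockEnd; apply: Prop_irrelevance.
Qed.

Lemma fock_end0_proof p f g :
  (fun=> 0) = (fun b => p * (fun=> 0) b + (fun=> 0) b) :> fock.
Proof. by apply: funext => b; rewrite mulr0 addr0. Qed.
Definition fock_end0 := @FockEnd (fun _ _ => 0) fock_end0_proof.

Lemma fock_end1_proof p f g :
  (fun b => p * f b + g b) = (fun b => p * f b + g b) :> fock.
Proof. by []. Qed.
Definition fock_end1 := @FockEnd id fock_end1_proof.

Lemma fock_end_add_proof S T p f g :
  (fun b => S (fun b => p * f b + g b) b + T (fun b => p * f b + g b) b) =
  (fun b => p * (S f b + T f b) + (S g b + T g b)).
Proof. by apply: funext => b; rewrite !fock_funP mulrDr addrACA. Qed.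
Definition fock_end_add S T :=
  @FockEnd (fun f b => S f b + T f b) (fock_end_add_proof S T).

Lemma fock_end_opp_proof S p f g :
  (fun b => - S (fun b => p * f b + g b) b) = (fun b => p * (- S f b) + - S g b).
Proof. by apply: funext => b; rewrite fock_funP opprD mulrN. Qed.
Definition fock_end_opp S :=
  @FockEnd (fun f b => - S f b) (fock_end_opp_proof S).

Lemma fock_end_mul_proof S T p f g :
  S (T (fun b => p * f b + g b)) = (fun b => p * S (T f) b + S (T g) b).
Proof. by rewrite !fock_funP. Qed.
Definition fock_end_mul S T :=
  @FockEnd (fun f => S (T f)) (fock_end_mul_proof S T).

Lemma fock_funD S f g : S (fun b => f b + g b) = (fun b => S f b + S g b).
Proof.
have := fock_funP S 1 f g; under eq_fun do rewrite mul1r.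
by move=> ->; apply: funext => b; rewrite mul1r.
Qed.

Lemma fock_fun0 S : S (fun=> 0) = (fun=> 0).
Proof.
have := fock_funD S (fun=> 0) (fun=> 0); under eq_fun do rewrite addr0.
move=> h; apply: funext => b; apply: (addrI (S (fun=> 0) b)).
by rewrite addr0 [in RHS]h.
Qed.

Lemma fock_funZ S p f : S (fun b => p * f b) = (fun b => p * S f b).
Proof.
have := fock_funP S p f (fun=> 0); under eq_fun do rewrite addr0.
by move=> ->; apply: funext => b; rewrite fock_fun0 addr0.
Qed.

Lemma fock_fun_sum (I : Type) (r : seq I) S (F : I -> fock) :
  S (fun b => \sum_(i <- r) F i b) = (fun b => \sum_(i <- r) S (F i) b).
Proof.
elim: r => [|i r IHr].
  under eq_fun do rewrite big_nil.
  by rewrite fock_fun0; apply: funext => b; rewrite big_nil.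
under eq_fun do rewrite big_cons.
by rewrite fock_funD IHr; apply: funext => b; rewrite big_cons.
Qed.

Lemma fock_end_addA : associative fock_end_add.
Proof. by move=> S T Q; apply: fock_endP => f b /=; rewrite addrA. Qed.
Lemma fock_end_addC : commutative fock_end_add.
Proof. by move=> S T; apply: fock_endP => f b /=; rewrite addrC. Qed.
Lemma fock_end_add0 : left_id fock_end0 fock_end_add.
Proof. by move=> S; apply: fock_endP => f b /=; rewrite add0r. Qed.
Lemma fock_end_addN : left_inverse fock_end0 fock_end_opp fock_end_add.
Proof. by move=> S; apply: fock_endP => f b /=; rewrite addNr. Qed.

HB.instance Definition _ := GRing.isZmodule.Build fock_end
  fock_end_addA fock_end_addC fock_end_add0 fock_end_addN.

Lemma fock_end_mulA : associative fock_end_mul.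
Proof. by move=> S T Q; apply: fock_endP. Qed.
Lemma fock_end_mul1 : left_id fock_end1 fock_end_mul.
Proof. by move=> S; apply: fock_endP. Qed.
Lemma fock_end_mulr1 : right_id fock_end1 fock_end_mul.
Proof. by move=> S; apply: fock_endP. Qed.
Lemma fock_end_mulDl : left_distributive fock_end_mul fock_end_add.
Proof. by move=> S T Q; apply: fock_endP. Qed.
Lemma fock_end_mulDr : right_distributive fock_end_mul fock_end_add.
Proof. by move=> S T Q; apply: fock_endP => f b /=; rewrite fock_funD. Qed.
Lemma fock_end_neq0 : fock_end1 != 0.
Proof.
apply/eqP => /(congr1 (fun S : fock_end => S (fun=> 1) (fun=> 0%N))) /= /eqP.
by rewrite oner_eq0.
Qed.

HB.instance Definition _ := GRing.Zmodule_isNzRing.Build fock_end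
  fock_end_mulA fock_end_mul1 fock_end_mulr1 fock_end_mulDl fock_end_mulDr
  fock_end_neq0.

Lemma fock_scal_proof q p f g :
  (fun b => q * (p * f b + g b)) = (fun b => p * (q * f b) + q * g b).
Proof. by apply: funext => b; rewrite mulrDr mulrCA. Qed.
Definition fock_scal q := @FockEnd (fun f b => q * f b) (fock_scal_proof q).

Lemma fock_scalB p q : fock_scal (p - q) = fock_scal p - fock_scal q.
Proof. by apply: fock_endP => f b /=; rewrite mulrBl. Qed.

Lemma fock_scalM p q : fock_scal (p * q) = fock_scal p * fock_scal q.
Proof. by apply: fock_endP => f b /=; rewrite mulrA. Qed.

Lemma fock_scal1 : fock_scal 1 = 1.
Proof. by apply: fock_endP => f b /=; rewrite mul1r. Qed.

Lemma fock_scalC p S : S * fock_scal p = fock_scal p * S.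
Proof. by apply: fock_endP => f b /=; rewrite fock_funZ. Qed.

Definition incr e b : X -> nat := fun x => (b x + (x == e))%N.
Definition decr e b : X -> nat := fun x => (b x - (x == e))%N.

(* [b] is the multidegree of a monomial and a function on multidegrees a formal power
   series; [up e] is multiplication by the variable [e] and [down e] its derivation. *)
Definition up_fun e f : fock := fun b => if b e == 0%N then 0 else f (decr e b).
Definition down_fun e f : fock := fun b => (b e).+1%:R * f (incr e b).

Lemma up_proof e p f g : up_fun e (fun b => p * f b + g b) =
  (fun b => p * up_fun e f b + up_fun e g b).
Proof.
by apply: funext => b; rewrite /up_fun; case: eqP => // _; rewrite mulr0 addr0.
Qed.
Definition up e := FockEnd (up_proof e).

Lemma down_proof e p f g : down_fun e (fun b => p * f b + g b) =
  (fun b => p * down_fun e f b + down_fun e g b).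
Proof. by apply: funext => b; rewrite /down_fun mulrDr mulrCA. Qed.
Definition down e := FockEnd (down_proof e).

Lemma upC e e' : up e * up e' = up e' * up e.
Proof.
have [->//|/negPf ne] := eqVneq e e'; apply: fock_endP => f b /=.
rewrite /up_fun /decr ne [e' == e]eq_sym ne !subn0; do 2 case: eqP => // _.
by congr (f _); apply: funext => x; rewrite subnAC.
Qed.

Lemma downC e e' : down e * down e' = down e' * down e.
Proof.
have [->//|/negPf ne] := eqVneq e e'; apply: fock_endP => f b /=.
rewrite /down_fun /incr ne [e' == e]eq_sym ne !addn0 mulrCA.
by congr (_ * (_ * f _)); apply: funext => x; rewrite addnAC.
Qed.

Lemma down_up e e' : down e * up e' - up e' * down e = (e == e')%:R.
Proof.
apply/eqP; rewrite subr_eq; apply/eqP.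
apply: fock_endP => f b; have [<-|/negPf ne] := eqVneq e e'.
  change (down_fun e (up_fun e f) b = f b + up_fun e (down_fun e f) b).
  rewrite /down_fun /up_fun /incr {1}/decr eqxx addn1 /=.
  have -> : (fun x => (b x + (x == e) - (x == e))%N) = b.
    by apply: funext => x; rewrite addnK.
  have [->|b0] := eqVneq (b e) 0%N; first by rewrite mul1r addr0.
  have -> : (fun x => decr e b x + (x == e))%N = b.
    apply: funext => x; rewrite /decr subnK //.
    by have [->|//] := eqVneq x e; rewrite lt0n.
  by rewrite /decr eqxx subn1 prednK ?lt0n // -[in LHS]add1n natrD mulrDl mul1r.
change (down_fun e (up_fun e' f) b = 0 + up_fun e' (down_fun e f) b).
rewrite add0r /down_fun /up_fun /incr [e' == e]eq_sym ne addn0.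
case: ifP => b0; first by rewrite mulr0.
rewrite {2}/decr ne subn0; congr (_ * f _); apply: funext => x.
rewrite /decr; have [->|_] := eqVneq x e'; last by rewrite !subn0.
by rewrite [e' == e]eq_sym ne !addn0.
Qed.

End FockSpace.

(** The variable [(i, a)] with a >= 1 stands for H_i t^(- a); the variables [(i, 0)] are kept out of
    the graded parts by [positive]. *)
Definition heis_end (R : realType) (n : nat) : nzRingType :=
  fock_end ('I_n * nat)%type {mpoly R[i][n]}.

(** * The action of the Heisenberg algebra *)

Section FockModule.
Import monalg mpoly.
Variables (R : realType) (n : nat).
Local Notation C := R[i].
Local Notation X := ('I_n * nat)%type.
Local Notation A := {mpoly C[n]}.
Local Notation E := (heis_end R n).
Local Notation word := {fmonom ('I_n * int)%type}.
Local Notation W := (Uheis R n).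

(** H_i t^0 is central and acts as the scalar h_i. For a >= 1, H_i t^(- a) multiplies by the
    variable [(i, a)], and H_i t^a is a times the derivation, the factor a coming from
    [H_i t^a, H_i t^(- a)] = a. As [Negz a] is - (a + 1), the index there is [a.+1]. *)
Definition mode_op (g : 'I_n * int) : E :=
  match g.2 with
  | Posz 0 => fock_scal X ('X_g.1)
  | Posz a.+1 => down A (g.1, a.+1) *+ a.+1
  | Negz a => up A (g.1, a.+1)
  end.

Lemma mode_op_rel i j a b :
  mode_op (i, a) * mode_op (j, b) - mode_op (j, b) * mode_op (i, a)
    = (a *+ ((i == j) && (a + b == 0)))%:~R.
Proof.
have scC p (S : E) : fock_scal X p * S - S * fock_scal X p = 0.
  by rewrite fock_scalC subrr.
have Csc p (S : E) : S * fock_scal X p - fock_scal X p * S = 0.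
  by rewrite fock_scalC subrr.
have du e k e' l : down A (e, k.+1) *+ k.+1 * up A (e', l.+1) -
    up A (e', l.+1) * (down A (e, k.+1) *+ k.+1)
  = ((e == e') && (k == l))%:R *+ k.+1.
  by rewrite mulrnAl mulrnAr -mulrnBl down_up xpair_eqE.
case: a b => [[|a]|a] [[|b]|b]; rewrite /mode_op ?scC ?Csc ?mul0rn //=.
- by rewrite addr0 andbF.
- by rewrite !mulrnAl !mulrnAr downC [X in X - _]mulrnAC subrr andbF.
- rewrite du; have -> : (Posz a.+1 + Negz b == 0) = (a == b) by lia.
  by case: andb; rewrite ?mulr1n ?mulr0n ?mul0rn.
- by rewrite addr0 andbF.
- rewrite -opprB du eq_sym [b == a]eq_sym.
  have -> : (Negz a + Posz b.+1 == 0) = (a == b) by lia.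
  have [->|_] := eqVneq a b; rewrite ?andbF ?mulr0n ?mul0rn ?oppr0 //.
  by rewrite !andbT; case: (i == j); rewrite ?mulr0n ?mul0rn ?oppr0 // NegzE.
- by rewrite upC subrr andbF.
Qed.

Definition word_op (w : word) : E := \prod_(g <- (w : seq ('I_n * int)%type)) mode_op g.

Lemma word_op_is_mmorphism : monalg.mmorphism word_op.
Proof.
by split=> [v w|]; rewrite /word_op ?fmM ?big_cat ?fm1 ?big_nil.
Qed.

HB.instance Definition _ :=
  monalg.isMultiplicative.Build word E word_op word_op_is_mmorphism.

Definition fock_const : C -> E := fun c => fock_scal X c%:MP.

Lemma fock_const_is_zmod_morphism : zmod_morphism fock_const.
Proof. by move=> c d; rewrite /fock_const mpolyCB fock_scalB. Qed.
Lemma fock_const_is_monoid_morphism : monoid_morphism fock_const.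
Proof.
by split=> [|c d]; rewrite /fock_const ?mpolyC1 ?fock_scal1 ?mpolyCM ?fock_scalM.
Qed.
HB.instance Definition _ := GRing.isZmodMorphism.Build C E fock_const
  fock_const_is_zmod_morphism.
HB.instance Definition _ := GRing.isMonoidMorphism.Build C E fock_const
  fock_const_is_monoid_morphism.

Definition free_act : hfree R n -> E := monalg.mmap fock_const word_op.

Lemma free_act_is_zmod_morphism : zmod_morphism free_act.
Proof. by move=> x y; rewrite /free_act (raddfB (monalg.mmap fock_const word_op)). Qed.
Lemma free_act_is_monoid_morphism : monoid_morphism free_act.
Proof.
have [] := monalg.commr_mmap_is_multiplicative (f := fock_const) (h := word_op).
  by move=> g m m'; rewrite /GRing.comm /fock_const fock_scalC.
by [].
Qed.
HB.instance Definition _ := GRing.isZmodMorphism.Build (hfree R n) E free_act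
  free_act_is_zmod_morphism.
HB.instance Definition _ := GRing.isMonoidMorphism.Build (hfree R n) E free_act
  free_act_is_monoid_morphism.

Lemma free_act_mon c w : free_act (hmon c w) = fock_const c * word_op w.
Proof. exact: monalg.mmapU. Qed.

Lemma free_act_gen i a : free_act (hgen R i a) = mode_op (i, a).
Proof.
rewrite /hgen /mode free_act_mon rmorph1 mul1r /word_op fmU.
exact: big_seq1.
Qed.

Lemma free_act_gen2 i a j b :
  free_act (hgen R i a * hgen R j b) = mode_op (i, a) * mode_op (j, b).
Proof.
exact: etrans (rmorphM free_act _ _) (congr2 *%R (free_act_gen i a) (free_act_gen j b)).
Qed.

Lemma free_act_rel x : heis_rel x -> free_act x = 0.
Proof.
case=> i [j [a [b ->]]]; apply: (etrans (rmorphB free_act _ _)).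
apply/eqP; rewrite subr_eq0; apply/eqP; apply: (etrans (rmorphB free_act _ _)).
apply: (etrans (congr2 (fun S T : E => S - T) (free_act_gen2 i a j b)
                                              (free_act_gen2 j b i a))).
by apply: (etrans (mode_op_rel i j a b)); apply/esym; apply: (rmorph_int free_act).
Qed.

Lemma free_act_presented x y : Upi R n x = Upi R n y -> free_act x = free_act y.
Proof.
move/eqP; rewrite /Upi /presented_pi tspi_eq => /asboolP h.
apply/eqP; rewrite -subr_eq0 -rmorphB; apply/eqP; move: (x - y) h.
apply: addspan_min => [|u v|_ [u [r [v [hr ->]]]]]; first exact: rmorph0.
  by rewrite rmorphD => -> ->; rewrite addr0.
by rewrite !rmorphM /= (free_act_rel hr) mulr0 mul0r.
Qed.

(** A preimage in the free algebra is chosen; by [free_act_presented] the value does not depend on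
    it. *)
Definition fock_act (w : W) : E := free_act (projT1 (cid (presented_piP w))).

Lemma fock_actE x : fock_act (Upi R n x) = free_act x.
Proof. by rewrite /fock_act; case: cid => y /= /esym/free_act_presented. Qed.

Lemma fock_act_is_zmod_morphism : zmod_morphism fock_act.
Proof.
move=> x y; have [u ->] := presented_piP x; have [v ->] := presented_piP y.
by rewrite -rmorphB !fock_actE rmorphB.
Qed.
Lemma fock_act_is_monoid_morphism : monoid_morphism fock_act.
Proof.
split=> [|x y]; first by rewrite -(rmorph1 (Upi R n)) fock_actE rmorph1.
have [u ->] := presented_piP x; have [v ->] := presented_piP y.
by rewrite -rmorphM !fock_actE rmorphM.
Qed.
HB.instance Definition _ := GRing.isZmodMorphism.Build W E fock_act
  fock_act_is_zmod_morphism.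
HB.instance Definition _ := GRing.isMonoidMorphism.Build W E fock_act
  fock_act_is_monoid_morphism.

Lemma fock_act_mon c w : fock_act (Umon c w) = fock_const c * word_op w.
Proof. by rewrite fock_actE free_act_mon. Qed.

Lemma fock_act_mode i a : fock_act (mode (@Umon R n) i a) = mode_op (i, a).
Proof. by rewrite /mode /Umon fock_actE -free_act_gen. Qed.

End FockModule.

(** * The grading of the Fock module *)

Section FockGrading.
Import monalg mpoly.
Variables (R : realType) (n : nat).
Local Notation C := R[i].
Local Notation X := ('I_n * nat)%type.
Local Notation A := {mpoly C[n]}.
Local Notation V := (fock X A).
Local Notation E := (heis_end R n).
Local Notation W := (Uheis R n).

(** The carrier of [E] is [fock_end] only up to unfolding, so application is given a name. *)
Definition end_app (S : E) : V -> V := fock_fun S.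
Definition act (w : W) : V -> V := end_app (fock_act w).

Lemma actM v w f : act (v * w) f = act v (act w f).
Proof. by rewrite /act rmorphM. Qed.

Lemma act1 f : act 1 f = f.
Proof. by rewrite /act rmorph1. Qed.

Lemma actD v w f : act (v + w) f = (fun b => act v f b + act w f b).
Proof. by rewrite /act rmorphD. Qed.

Lemma actB v w f : act (v - w) f = (fun b => act v f b - act w f b).
Proof. by rewrite /act rmorphB. Qed.

Lemma act0 f : act 0 f = (fun=> 0).
Proof. by rewrite /act rmorph0. Qed.

Lemma act_fun0 w : act w (fun=> 0) = (fun=> 0).
Proof. exact: fock_fun0. Qed.

Lemma act_mode i a f : act (mode (@Umon R n) i a) f = end_app (mode_op R (i, a)) f.
Proof. by rewrite /act fock_act_mode. Qed.

Definition weight (s : seq X) : nat := \sum_(e <- s) e.2.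
Definition mult (s : seq X) : X -> nat := fun x => count_mem x s.
Definition positive (s : seq X) : bool := all (fun e => (0 < e.2)%N) s.

(** A finite list [s] of variables encodes a monomial through its multiplicities. The degree is an
    integer, so that an operator leading below degree 0 is seen to give 0 by [fock_deg_neg]. *)
Definition fock_deg (m : int) (f : V) : Prop := forall b, f b <> 0 ->
  exists s, [/\ positive s, (weight s)%:Z = m & b = mult s].

Lemma mult_cons e s : mult (e :: s) = incr e (mult s).
Proof. by apply: funext => x; rewrite /mult /incr /= addnC eq_sym. Qed.

Lemma mult_rem e s : e \in s -> mult (rem e s) = decr e (mult s).
Proof.
by move=> es; apply: funext => x; rewrite /mult /decr count_rem es /= eq_sym.
Qed.

Lemma decr_incr e (b : X -> nat) : decr e (incr e b) = b.
Proof. by apply: funext => x; rewrite /decr /incr addnK. Qed.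

Lemma incr_decr e (b : X -> nat) : b e != 0%N -> incr e (decr e b) = b.
Proof.
move=> be; apply: funext => x; rewrite /decr /incr.
by have [->|_] := eqVneq x e; rewrite ?subn0 ?addn0 // subnK // lt0n.
Qed.

Lemma weight_cons e s : weight (e :: s) = (e.2 + weight s)%N.
Proof. by rewrite /weight big_cons. Qed.

Lemma weight_rem e s : e \in s -> weight s = (e.2 + weight (rem e s))%N.
Proof. by move=> es; rewrite -weight_cons /weight (perm_big _ (perm_to_rem es)). Qed.

Lemma positive_rem e s : positive s -> positive (rem e s).
Proof. by move=> /allP h; apply/allP => x /mem_rem/h. Qed.

Lemma fock_deg0 m : fock_deg m (fun=> 0).
Proof. by move=> b. Qed.

Lemma fock_degD m f g : fock_deg m f -> fock_deg m g -> fock_deg m (fun b => f b + g b).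
Proof.
move=> hf hg b h; have [f0|/eqP fb] := eqVneq (f b) 0; last exact: hf.
by apply: hg => g0; apply: h; rewrite f0 g0 addr0.
Qed.

Lemma fock_degZ m p f : fock_deg m f -> fock_deg m (fun b => p * f b).
Proof. by move=> hf b h; apply: hf => f0; apply: h; rewrite f0 mulr0. Qed.

Lemma fock_degMn m k f : fock_deg m f -> fock_deg m (fun b => f b *+ k).
Proof. by move=> hf b h; apply: hf => f0; apply: h; rewrite f0 mul0rn. Qed.

Lemma fock_deg_neg m f : m < 0 -> fock_deg m f -> f = (fun=> 0).
Proof.
move=> m0 hf; apply: funext => b; have [//|/eqP/hf [s [_ e _]]] := eqVneq (f b) 0.
by move: m0; rewrite -e.
Qed.

Lemma end_appMn (S : E) k f : end_app (S *+ k) f = (fun b => end_app S f b *+ k).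
Proof.
elim: k => [|k IHk] //; apply: funext => b; rewrite !mulrSr.
by rewrite -[LHS]/(end_app (S *+ k) f b + end_app S f b) IHk.
Qed.

Lemma mode_op_deg m g f :
  fock_deg m f -> fock_deg (m - g.2) (end_app (mode_op R g) f).
Proof.
case: g => i a hf; case: a => [[|a]|a] /=.
- rewrite subr0; exact: fock_degZ.
- rewrite {1}/mode_op /= end_appMn; apply: fock_degMn => b h.
  have /hf [s [ps ws e]] : f (incr (i, a.+1) b) <> 0.
    by move=> f0; apply: h; rewrite /end_app /= /down_fun f0 mulr0.
  have es : (i, a.+1) \in s.
    rewrite -has_pred1 has_count -/(mult s (i, a.+1)) -e /incr eqxx; lia.
  exists (rem (i, a.+1) s); split; first exact: positive_rem.
    by rewrite -ws (weight_rem es) /=; lia.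
  by rewrite mult_rem // -e decr_incr.
move=> b; rewrite /end_app /= /up_fun; case: eqP => // /eqP b0.
move=> /hf [s [ps ws e]]; exists ((i, a.+1) :: s); split=> //.
  by rewrite weight_cons /=; lia.
by rewrite mult_cons -e incr_decr.
Qed.

Lemma act_deg k w : mode_deg (@Umon R n) k w ->
  forall m f, fock_deg m f -> fock_deg (m + k) (act w f).
Proof.
move: w; apply: addspan_min => [m f hf|v w hv hw m f hf|_ [c [w [<- ->]]] m f hf].
- by rewrite act0; apply: fock_deg0.
- by rewrite actD; apply: fock_degD; [apply: hv|apply: hw].
rewrite /act fock_act_mon; apply: fock_degZ.
rewrite /word_op /word_deg; elim: (w : seq _) => [|g s IHs].
  by rewrite !big_nil addr0.
rewrite !big_cons addrCA addrC.
exact: mode_op_deg.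
Qed.

(** The rightmost factor H_i t^a, with a >= N > m, already leads to negative degree. Hence on the
    part of degree m an element of the completion acts through any of its components of index >
    m. *)
Lemma act_filt N w m f : w \in heis_filt R n N -> fock_deg m f ->
  m < N%:Z -> act w f = (fun=> 0).
Proof.
move=> /asboolP hw hf mN; move: w hw; apply: addspan_min => [|v w hv hw|].
- exact: act0.
- by rewrite actD hv hw; apply: funext => b; rewrite addr0.
move=> _ [v [_ [_ [i [a [Na ->]]] ->]]]; rewrite actM act_mode.
have /fock_deg_neg -> : fock_deg (m - a) (end_app (mode_op R (i, a)) f).
- exact: mode_op_deg hf.
- exact: act_fun0.
by rewrite subr_lt0 (lt_le_trans mN).
Qed.

End FockGrading.

(** * Normal ordering *)

Section NormalOrdering.
Import monalg mpoly.
Variables (R : realType) (n : nat).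
Local Notation C := R[i].
Local Notation I := ('I_n * int)%type.
Local Notation W := (Uheis R n).
Implicit Types (c d : C) (g h : I) (r s t : seq I).

Definition monomial c s : W := Umon c (FMonom s).

Lemma Umon_monomial c (w : {fmonom I}) : Umon c w = monomial c w.
Proof. by rewrite /monomial fmK. Qed.

Lemma monomialM c d s t : monomial c s * monomial d t = monomial (c * d) (s ++ t).
Proof.
by rewrite /monomial UmonM; congr Umon; apply: val_inj; rewrite /= fmM.
Qed.

Lemma monomialD c d s : monomial (c + d) s = monomial c s + monomial d s.
Proof. by rewrite /monomial /Umon -rmorphD /hmon -monalgUD. Qed.

Lemma monomial0 s : monomial 0 s = 0.
Proof. by apply: (addrI (monomial 0 s)); rewrite -monomialD !addr0. Qed.

Lemma monomialN c s : monomial (- c) s = - monomial c s.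
Proof. by apply/eqP; rewrite -addr_eq0 -monomialD addNr monomial0. Qed.

Lemma monomial1 : monomial 1 [::] = 1.
Proof. by rewrite /monomial -fmoneE; apply: Umon1. Qed.

Lemma monomial_int (z : int) : monomial z%:~R [::] = z%:~R.
Proof.
have nat m : monomial m%:R [::] = m%:R.
  elim: m => [|m IHm]; first exact: monomial0.
  by rewrite -addn1 !natrD monomialD IHm monomial1.
by case: z => m; rewrite ?NegzE ?mulrNz ?monomialN -!pmulrn nat.
Qed.

Lemma mode_monomial (i : 'I_n) (a : int) :
  mode (@Umon R n) i a = monomial 1 [:: (i, a)].
Proof. by rewrite /mode fmuE. Qed.

Definition bracket g h : int := g.2 *+ ((g.1 == h.1) && (g.2 + h.2 == 0)).

Lemma monomial_swap c s g h t : monomial c (s ++ g :: h :: t) =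
  monomial c (s ++ h :: g :: t) + monomial (c * (bracket g h)%:~R) (s ++ t).
Proof.
have e : monomial 1 [:: g] * monomial 1 [:: h]
       = monomial 1 [:: h] * monomial 1 [:: g] + monomial (bracket g h)%:~R [::].
  case: g h => i a [j b]; apply/eqP; rewrite addrC -subr_eq -subr_eq0.
  rewrite monomial_int -!mode_monomial.
  have h : @heis_rel R n (hgen R i a * hgen R j b -
    hgen R j b * hgen R i a - (bracket (i, a) (j, b))%:~R) by exists i, j, a, b.
  apply/eqP; change (Upi R n (hgen R i a) * Upi R n (hgen R j b) -
    Upi R n (hgen R j b) * Upi R n (hgen R i a) - (bracket (i, a) (j, b))%:~R = 0).
  by rewrite -(rmorph_int (Upi R n)) -!(rmorphM (Upi R n)) -!(rmorphB (Upi R n))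
             (presented_rel h).
have -> : monomial c (s ++ g :: h :: t) =
    monomial c s * (monomial 1 [:: g] * monomial 1 [:: h]) * monomial 1 t.
  by rewrite !monomialM !mulr1 -catA.
rewrite e mulrDr mulrDl; congr (_ + _); last first.
  by rewrite !monomialM cats0 (mulr1 (c * _)).
by rewrite !monomialM !mulr1 -catA.
Qed.

Definition commutes g h : bool := bracket g h == 0.

Lemma monomial_move c s g t r : all (commutes g) t ->
  monomial c (s ++ g :: t ++ r) = monomial c (s ++ t ++ g :: r).
Proof.
elim: t s => [//|h t IHt] s /= /andP[/eqP gh /IHt ht].
by rewrite monomial_swap gh mulr0 monomial0 addr0 -cat_rcons ht -!cat_rcons.
Qed.

Lemma monomial_perm (P : pred I) c s t t' r : {in P &, forall g h, commutes g h} ->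
  all P t -> perm_eq t t' -> monomial c (s ++ t ++ r) = monomial c (s ++ t' ++ r).
Proof.
move=> PC; elim: t s t' => [|g t IHt] s t' Pt.
  by move/perm_size/esym/size0nil=> ->.
move=> gtt'; have gt' : g \in t' by rewrite -(perm_mem gtt') mem_head.
case/splitPr: gt' gtt' => t1 t2 tt'.
have Pt' : all P (t1 ++ g :: t2) by rewrite -(perm_all _ tt').
have {}tt' : perm_eq t (t1 ++ t2).
  by rewrite -(perm_cons g) (perm_trans tt') // perm_catC /= perm_cons perm_catC.
rewrite -catA /= -(monomial_move _ _ (t := t1)).
  rewrite -!cat_rcons (IHt _ (t1 ++ t2)) -?catA //; first by case/andP: Pt.
move: Pt'; rewrite all_cat => /andP[/allP Pt1 /= /andP[Pg _]].
by apply/allP => h /Pt1; apply: PC.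
Qed.

Definition mode_neg g := g.2 < 0.
Definition mode_zero g := g.2 == 0.
Definition mode_pos g := 0 < g.2.

Lemma mode_neg_comm : {in mode_neg &, forall g h, commutes g h}.
Proof.
move=> g h; rewrite !unfold_in /commutes /bracket => g0 h0.
by rewrite (_ : _ + _ == 0 = false) ?andbF //; lia.
Qed.

Lemma mode_pos_comm : {in mode_pos &, forall g h, commutes g h}.
Proof.
move=> g h; rewrite !unfold_in /commutes /bracket => g0 h0.
by rewrite (_ : _ + _ == 0 = false) ?andbF //; lia.
Qed.

Lemma mode_zero_comm g h : mode_zero g -> commutes g h.
Proof. by rewrite /commutes /bracket => /eqP->; rewrite mul0rn. Qed.

Definition sdeg s : int := \sum_(g <- s) - g.2.

Lemma sdeg_cat s t : sdeg (s ++ t) = sdeg s + sdeg t.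
Proof. by rewrite /sdeg big_cat. Qed.

Lemma sdeg_cons g s : sdeg (g :: s) = - g.2 + sdeg s.
Proof. by rewrite /sdeg big_cons. Qed.

Lemma sdeg_nil : sdeg [::] = 0.
Proof. exact: big_nil. Qed.

Lemma sdeg_zero s : all mode_zero s -> sdeg s = 0.
Proof.
elim: s => [|g s IHs] /=; first by rewrite /sdeg big_nil.
by case/andP=> /eqP g0 /IHs s0; rewrite sdeg_cons g0 s0.
Qed.

Definition normal_words k (x : W) := exists c s1 s2 s3,
  [/\ all mode_neg s1, all mode_zero s2, all mode_pos s3,
      sdeg s1 + sdeg s3 = k & x = monomial c (s1 ++ s2 ++ s3)].

(* Moving a positive mode to the right through negative ones only adds terms where it
   has been cancelled against one of them. *)
Lemma normal_pos_past c g t s1 s2 s3 : mode_pos g ->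
    all mode_neg t -> all mode_neg s1 -> all mode_zero s2 -> all mode_pos s3 ->
  addspan (normal_words (sdeg t + sdeg s1 + sdeg s3 - g.2))
          (monomial c (t ++ g :: s1 ++ s2 ++ s3)).
Proof.
move=> g0 ht h1 h2 h3; elim: s1 h1 t c ht => [_|h s1 IHs /= /andP[h0 h1]] t c ht.
  rewrite cat0s (monomial_move _ _ (t := s2)); last first.
    apply/allP => h hs2; have /eqP h0 : mode_zero h := allP h2 h hs2.
    rewrite /commutes /bracket.
    by rewrite (_ : _ + _ == 0 = false) ?andbF //; move: g0; rewrite /mode_pos; lia.
  apply: addspan_gen; exists c, t, s2, (g :: s3); split=> //=.
    by rewrite g0.
  by rewrite sdeg_cons sdeg_nil; lia.
rewrite monomial_swap; apply: addspanD.
  have -> : sdeg t + sdeg (h :: s1) = sdeg (rcons t h) + sdeg s1.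
    by rewrite -cats1 sdeg_cat !sdeg_cons sdeg_nil; lia.
  by rewrite -cat_rcons; apply: IHs => //; rewrite all_rcons ht andbT.
have [->|gh] := eqVneq (bracket g h) 0.
  by rewrite mulr0 monomial0; apply: addspan0.
have /eqP {}gh : g.2 + h.2 == 0.
  by move: gh; rewrite /bracket; case: (_ + _ == 0); rewrite // andbF mulr0n.
apply: addspan_gen; exists (c * (bracket g h)%:~R), (t ++ s1), s2, s3; split=> //.
- by rewrite all_cat ht h1.
- by rewrite sdeg_cat sdeg_cons; lia.
by rewrite catA.
Qed.

(** A negative mode is just put in front; a zero mode commutes with everything and joins the zero
    modes; a positive mode is moved to the right by [normal_pos_past]. *)
Lemma normal_mode g k x : addspan (normal_words k) x ->
  addspan (normal_words (k - g.2)) (monomial 1 [:: g] * x).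
Proof.
move: x; apply: addspan_min => [|x y|_ [c [s1 [s2 [s3 [h1 h2 h3 <- ->]]]]]].
- by rewrite mulr0; apply: addspan0.
- by rewrite mulrDr; apply: addspanD.
rewrite monomialM mul1r /=.
have [g0|g0|g0] := ltgtP g.2 0.
- apply: addspan_gen; exists c, (g :: s1), s2, s3; split=> //=.
    by rewrite h1 andbT.
  by rewrite sdeg_cons; lia.
- have := @normal_pos_past c g [::] s1 s2 s3 g0 isT h1 h2 h3.
  by rewrite sdeg_nil add0r.
have cg : all (commutes g) s1 by apply/allP => h _; apply/mode_zero_comm/eqP.
rewrite -[g :: _]cat0s monomial_move //; apply: addspan_gen.
exists c, s1, (g :: s2), s3; split=> //=; last by rewrite g0 subr0.
by rewrite h2 andbT; apply/eqP.
Qed.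

Lemma normal_monomial c s : addspan (normal_words (sdeg s)) (monomial c s).
Proof.
elim: s => [|g s IHs].
  by apply: addspan_gen; exists c, [::], [::], [::]; rewrite /sdeg big_nil addr0.
have -> : monomial c (g :: s) = monomial 1 [:: g] * monomial c s.
  by rewrite monomialM mul1r.
by rewrite sdeg_cons addrC; apply: normal_mode.
Qed.

Lemma normal_deg k x : heis_grading R n k x -> addspan (normal_words k) x.
Proof.
move: x; apply: addspan_min => [|x y|_ [c [w [<- ->]]]].
- exact: addspan0.
- exact: addspanD.
by rewrite Umon_monomial; apply: normal_monomial.
Qed.

Lemma monomial_deg c s : heis_grading R n (sdeg s) (monomial c s).
Proof.
by apply: addspan_gen; exists c, (FMonom s); split.
Qed.

End NormalOrdering.

(** * Infinite sums in the completion *)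

Section InfiniteSums.
Variables (W : pzRingType) (L : lfilt W) (G : grading W).
Local Notation U := (invlim L).
Implicit Types (x y z : U) (t : nat -> U).

Lemma compD x y N : (x + y) N = x N + y N. Proof. by []. Qed.

Lemma comp0 N : (0 : U) N = 0. Proof. exact: lpi0. Qed.

Lemma comp_sum (I : Type) (r : seq I) (F : I -> U) N :
  (\sum_(i <- r) F i) N = \sum_(i <- r) F i N.
Proof. by apply: (big_morph (fun x : U => x N)) => //; apply: comp0. Qed.

Lemma comp_eq0_le x M N : (M <= N)%N -> x N = 0 -> x M = 0.
Proof. by rewrite -!lpi0; apply: comp_le. Qed.

Lemma comp_mul0 x y N : y N = 0 -> (x * y) N = 0.
Proof.
move=> y0; have [a xa] := invlim_rep x N.
rewrite -[LHS]/(lim_mul_seq x y N) (@lim_mul_seqE _ _ x y N N a 0) ?y0 ?lpi0 //.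
  by rewrite mulr0 lpi0.
by move=> u _; rewrite mulr0 rpred0.
Qed.

Lemma comp_mulr x y y' N : y N = y' N -> (x * y) N = (x * y') N.
Proof. by move=> e; rewrite -[LHS]/(lim_mul_seq x y N) /lim_mul_seq e. Qed.

Lemma limCM a b : limC L (a * b) = limC L a * limC L b.
Proof.
apply: invlimP => N; have [M gb] := good_ex L N b.
by rewrite -[RHS]/(lim_mul_seq _ _ N) (@lim_mul_seqE _ _ _ _ M N a b).
Qed.

Lemma limCD a b : limC L (a + b) = limC L a + limC L b.
Proof. by apply: invlimP => N; rewrite /= lpiD. Qed.

Lemma limCB a b : limC L (a - b) = limC L a - limC L b.
Proof. by apply: invlimP => N; rewrite /= lpiB. Qed.

Lemma limC_sum (I : Type) (r : seq I) (F : I -> W) :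
  limC L (\sum_(i <- r) F i) = \sum_(i <- r) limC L (F i).
Proof. exact: (big_morph _ limCD). Qed.

Lemma lpi_eq0 N w : w \in L N -> lpi L N w = 0.
Proof. by move=> h; apply/eqP; rewrite -lpi0 lpi_eq subr0. Qed.

Lemma U_deg_limC k w : G k w -> U_deg G k (limC L w).
Proof. by move=> h N; exists w. Qed.

Lemma U_deg0 k : U_deg G k (0 : U).
Proof. by move=> N; exists 0; rewrite ?comp0 ?lpi0 //; apply: gr_deg0. Qed.

Lemma U_deg_sum (I : Type) (r : seq I) k (F : I -> U) :
  (forall i, U_deg G k (F i)) -> U_deg G k (\sum_(i <- r) F i).
Proof.
move=> h; apply: big_ind => [|x y|i _] //; first exact: U_deg0.
exact: U_degD.
Qed.

Section Sum.
Variables (t : nat -> U) (t0 : forall N, t N N = 0).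

Lemma lim_sum_coh N : ltrans ((\sum_(i < N.+1) t i) N.+1) = (\sum_(i < N) t i) N.
Proof. by rewrite comp_coh big_ord_recr compD t0 addr0. Qed.

(** The infinite sum of the [t i]: in the component [N] all terms with i >= N vanish, so the partial
    sum up to [N] is already exact there. *)
Definition lim_sum : U := InvLim lim_sum_coh.

Lemma lim_sumE M N : (N <= M)%N -> lim_sum N = (\sum_(i < M) t i) N.
Proof.
move=> NM; rewrite -(subnKC NM); elim: (M - N)%N => [|m IHm]; first by rewrite addn0.
rewrite addnS big_ord_recr compD -IHm.
by rewrite (comp_eq0_le _ (t0 (N + m))) ?leq_addr // addr0.
Qed.

Lemma lim_sum_deg k : (forall N, U_deg G k (t N)) -> U_deg G k lim_sum.
Proof. by move=> ht N; apply: (U_deg_sum (index_enum _) (F := fun i : 'I_N => t i)). Qed.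

End Sum.

Lemma comp_mulr_eq0 y t (t0 : forall N, t N N = 0) N : (y * t N) N = 0.
Proof. exact: comp_mul0. Qed.

Lemma mul_lim_sum y t (t0 : forall N, t N N = 0) :
  y * lim_sum t0 = lim_sum (comp_mulr_eq0 y t0).
Proof.
apply: invlimP => N; rewrite (@comp_mulr y _ (\sum_(i < N) t i)) //.
by rewrite mulr_sumr.
Qed.

(** Representatives [w N] of the components of [x] turn it into a convergent series, whose terms are
    differences lying in [L N]. *)
Lemma lim_telescope (x : U) (w : nat -> W)
    (t0 : forall N, limC L (w N.+1 - w N) N = 0) :
  (forall N, x N = lpi L N (w N)) -> x = limC L (w 0%N) + lim_sum t0.
Proof.
move=> xw; apply: invlimP => N; rewrite compD.
rewrite -[X in _ = _ + X]/((\sum_(i < N) limC L (w i.+1 - w i)) N) -limC_sum.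
rewrite -(big_mkord xpredT (fun i => w i.+1 - w i)) telescope_sumr //=.
by rewrite -lpiD addrC subrK.
Qed.

(* A finite family [y] of homogeneous elements, [y i] of degree [dy i]. *)
Section RightSpan.
Variables (T : finType) (y : T -> U) (dy : T -> int).
Hypothesis y_deg : forall i, U_deg G (dy i) (y i).

(** The part of degree [m] of the right ideal generated by the [y i], with homogeneous
    coefficients. *)
Definition right_span m x := exists z : T -> U,
  (forall i, U_deg G (m - dy i) (z i)) /\ x = \sum_i y i * z i.

Lemma right_spanD m x x' : right_span m x -> right_span m x' -> right_span m (x + x').
Proof.
move=> [z [hz ->]] [z' [hz' ->]]; exists (fun i => z i + z' i); split.
  by move=> i; apply: U_degD.
by rewrite -big_split; apply: eq_bigr => i _; rewrite mulrDr.
Qed.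

Lemma right_span0 m : right_span m 0.
Proof.
exists (fun=> 0); split=> [i|]; first exact: U_deg0.
by rewrite big1 // => i _; rewrite mulr0.
Qed.

Lemma right_spanM m l x u : right_span m x -> U_deg G l u -> right_span (m + l) (x * u).
Proof.
move=> [z [hz ->]] hu; exists (fun i => z i * u); split.
  by move=> i; rewrite addrAC; apply: U_degM.
by rewrite mulr_suml; apply: eq_bigr => i _; rewrite mulrA.
Qed.

Lemma right_span_gen i l u : U_deg G l u -> right_span (dy i + l) (y i * u).
Proof.
move=> hu; exists (fun j => if j == i then u else 0); split=> [j|].
  by case: eqP => [->|_]; [rewrite addrAC subrr add0r|apply: U_deg0].
rewrite (bigD1 i) //= eqxx big1 ?addr0 // => j /negPf ->.
by rewrite mulr0.
Qed.

(** Elements of degree 0 of the right ideal whose coefficients vanish in the component [N]. A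
    sequence of such coefficients, one for each [N], can be summed. *)
Definition small_span N x := exists z : T -> U,
  (forall i, U_deg G (- dy i) (z i) /\ z i N = 0) /\ x = \sum_i y i * z i.

Lemma small_spanD N x x' : small_span N x -> small_span N x' -> small_span N (x + x').
Proof.
move=> [z [hz ->]] [z' [hz' ->]]; exists (fun i => z i + z' i); split.
  move=> i; have [h1 h2] := hz i; have [h1' h2'] := hz' i.
  by split; [apply: U_degD|rewrite compD h2 h2' addr0].
by rewrite -big_split; apply: eq_bigr => i _; rewrite mulrDr.
Qed.

Lemma small_span0 N : small_span N 0.
Proof.
exists (fun=> 0); split=> [i|]; first by split; [apply: U_deg0|rewrite comp0].
by rewrite big1 // => i _; rewrite mulr0.
Qed.

Lemma small_spanM N m x u : right_span m x -> U_deg G (- m) u -> u N = 0 ->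
  small_span N (x * u).
Proof.
move=> [z [hz ->]] hu u0; exists (fun i => z i * u); split.
  move=> i; split; last exact: comp_mul0.
  by rewrite (_ : - dy i = m - dy i - m); [apply: U_degM|rewrite addrAC subrr add0r].
by rewrite mulr_suml; apply: eq_bigr => i _; rewrite mulrA.
Qed.

(** All terms use the same finitely many [y i], so the sum over N may be moved into the
    coefficients. The coefficient of [y i] becomes an infinite sum of degree - [dy i] <= - d - 1,
    and a finite sum of products is left. *)
Lemma lim_sum_level d t (t0 : forall N, t N N = 0) :
  (forall i, d%:Z + 1 <= dy i) -> (forall N, small_span N (t N)) ->
  prodspan (@U_gr _ L G) (@U_le _ L G (- d%:Z - 1)) (lim_sum t0).
Proof.
move=> hdy /boolp.choice [z hz].
have z0 i N : z N i N = 0 by have [/(_ i) []] := hz N.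
have -> : lim_sum t0 = \sum_i y i * lim_sum (z0 i).
  apply: invlimP => N; rewrite comp_sum.
  transitivity (\sum_i (lim_sum (comp_mulr_eq0 (y i) (z0 i))) N); last first.
    by apply: eq_bigr => i _; rewrite mul_lim_sum.
  transitivity (\sum_(j < N) \sum_i (y i * z j i) N).
    rewrite -[LHS]/((\sum_(j < N) t j) N) comp_sum; apply: eq_bigr => j _.
    by rewrite (proj2 (hz j)) comp_sum.
  by rewrite exchange_big; apply: eq_bigr => i _; rewrite -comp_sum.
apply: big_ind => [|u v|i _]; [exact: addspan0|exact: addspanD|].
apply: addspan_gen; exists (y i), (lim_sum (z0 i)); split=> //.
  by apply: addspan_gen; exists (dy i).
apply: addspan_gen; exists (- dy i); first by have := hdy i; lia.
by apply: lim_sum_deg => N; have [/(_ i) []] := hz N.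
Qed.

End RightSpan.
End InfiniteSums.

Lemma sum_commutator (S : pzRingType) (J : finType) (F : J -> S) x :
  (\sum_j F j) * x - x * (\sum_j F j) = \sum_j (F j * x - x * F j).
Proof. by rewrite mulr_suml mulr_sumr sumrB. Qed.

(** * A finitely generated right ideal *)

Section RightGenerators.
Variables (R : realType) (n : nat) (k' : nat).
Local Notation k := k'.+1.
Local Notation C := R[i].
Local Notation I := ('I_n * int)%type.
Local Notation W := (Uheis R n).
Local Notation L := (heis_filt R n).
Local Notation G := (heis_grading R n).
Local Notation U := (invlim L).
Local Notation lim := (limC L).
Local Notation mon := (@monomial R n).

Lemma monomial_filt c s i (a : int) N : N%:Z <= a ->
  mon c (rcons s (i, a)) \in L N.
Proof.
move=> Na; rewrite -cats1 -[c]mulr1 -(@monomialM R n) -(@mode_monomial R n).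
by apply/mode_left_mull/mode_left_gen.
Qed.

(* The part j = l of the element D of the header; it is 0 for l = 0, as 0^-1 = 0. *)
Definition shift_part (l : nat) : W :=
  \sum_(i < n) mon l%:R^-1 [:: (i, - (k + l)%:Z); (i, l%:Z)].

Lemma shift_part_filt l : shift_part l \in L l.
Proof.
by apply: rpred_sum => i _; apply: (monomial_filt _ [:: _]).
Qed.

Lemma shift_part0 l : lim (shift_part l) l = 0.
Proof. exact/lpi_eq0/shift_part_filt. Qed.

Lemma shift_part_deg l : G k%:Z (shift_part l).
Proof.
apply: big_ind => [|x y hx hy|i _]; first exact: gr_deg0.
  exact: gr_degD.
have -> : k%:Z = sdeg [:: (i, - (k + l)%:Z); (i, l%:Z)].
  by rewrite !sdeg_cons sdeg_nil /=; lia.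
exact: monomial_deg.
Qed.

Definition shift : U := lim_sum shift_part0.

Lemma shift_deg : U_deg G k%:Z shift.
Proof. by apply: lim_sum_deg => N; apply/U_deg_limC/shift_part_deg. Qed.

(** Two negative modes commute, so only H_i t^l can fail to commute with H_j t^(- b), and only for i
    = j and l = b. The bracket is then b, which cancels the coefficient b^-1. *)
Lemma shift_part_comm j (b l : nat) : (0 < b)%N ->
  shift_part l * mon 1 [:: (j, - b%:Z)]
    - mon 1 [:: (j, - b%:Z)] * shift_part l
  = if l == b then mon 1 [:: (j, - (k + b)%:Z)] else 0.
Proof.
move=> b0; rewrite /shift_part sum_commutator.
have term (c : C) (i : 'I_n) : mon c [:: (i, - (k + l)%:Z); (i, l%:Z)] *
    mon 1 [:: (j, - b%:Z)] - mon 1 [:: (j, - b%:Z)] *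
    mon c [:: (i, - (k + l)%:Z); (i, l%:Z)]
  = mon (c * (bracket (i, l%:Z) (j, - b%:Z))%:~R) [:: (i, - (k + l)%:Z)].
  rewrite [X in X - _](@monomialM R n) [X in _ - X](@monomialM R n).
  rewrite (mul1r c) (mulr1 c) /=.
  rewrite (@monomial_swap R n _ [:: (i, _)] _ _ [::]) /=.
  rewrite (@monomial_swap R n _ [::] _ _ [:: (i, l%:Z)]) /=.
  have -> : bracket (i, - (k + l)%:Z) (j, - b%:Z) = 0.
    by apply/eqP/mode_neg_comm; rewrite unfold_in /mode_neg /=; lia.
  by rewrite mulr0 (@monomial0 R n) addr0 addrC addKr.
under eq_bigr => i _ do rewrite term; rewrite /bracket /=.
have [->|lb] := eqVneq l b; last first.
  rewrite big1 // => i _; have -> : (l%:Z + - b%:Z == 0) = false by lia.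
  by rewrite andbF mulr0n mulr0 (@monomial0 R n).
rewrite (bigD1 j) //= big1 ?addr0 => [|i /negPf ->]; last first.
  by rewrite mulr0n mulr0 (@monomial0 R n).
by rewrite eqxx subrr eqxx mulr1n -pmulrn mulVf // pnatr_eq0 -lt0n.
Qed.

Lemma shift_comm j (b : nat) : (0 < b)%N ->
  shift * lim (mon 1 [:: (j, - b%:Z)])
    - lim (mon 1 [:: (j, - b%:Z)]) * shift
  = lim (mon 1 [:: (j, - (k + b)%:Z)]).
Proof.
move=> b0; set h := mon 1 [:: (j, - b%:Z)]; apply: invlimP => N.
(* The partial sum of length [M] represents D in the components [M] and [N], and [M] is large enough
   for the component [N] of D h to be computed from it. Being > b, it also includes the only
   contributing term, l = b. *)
have [M0 gM0] := good_ex L N h; set M := maxn (maxn M0 N) b.+1.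
have gM : good L M N h by apply: good_le gM0; rewrite // /M; lia.
have NM : (N <= M)%N by rewrite /M; lia.
set s := \sum_(l < M) shift_part l.
have sM : shift M = lpi L M s.
  by rewrite (lim_sumE _ (leqnn M)) -limC_sum.
have sN : shift N = lpi L N s by rewrite (lim_sumE _ NM) -limC_sum.
have -> : (shift * lim h - lim h * shift) N = lim (s * h - h * s) N.
  have e1 : (shift * lim h) N = lim (s * h) N.
    by rewrite -[LHS]/(lim_mul_seq _ _ N) (lim_mul_seqE sM (erefl : lim h N = _) gM).
  have e2 : (lim h * shift) N = lim (h * s) N.
    by rewrite limCM; apply: comp_mulr.
  by rewrite limCB -[LHS]/((shift * lim h) N - (lim h * shift) N) e1 e2.
congr (lim _ N); rewrite /s sum_commutator.
under eq_bigr => l _ do rewrite shift_part_comm //.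
have bM : (b < M)%N by rewrite /M; lia.
rewrite (bigD1 (Ordinal bM)) //= eqxx big1 ?addr0 // => l.
by rewrite -val_eqE => /= /negPf ->.
Qed.

(** [None] indexes D, and [Some s] the words of at most k modes H_i t^(- a) with a < 2 k. *)
Local Notation T := (option (k.-bseq ('I_n * 'I_(2 * k))%type)).

Definition neg_word (s : seq ('I_n * 'I_(2 * k))) : seq I :=
  [seq (e.1, - Posz (nat_of_ord e.2)) | e <- s].

(* Words of degree < k are replaced by 0, so that all generators have degree >= k. *)
Definition rgen (t : T) : U :=
  if t is Some s then
    if k%:Z <= sdeg (neg_word s) then lim (mon 1 (neg_word s)) else 0
  else shift.

Definition rgen_deg (t : T) : int :=
  if t is Some s then
    if k%:Z <= sdeg (neg_word s) then sdeg (neg_word s) else k%:Z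
  else k%:Z.

Lemma rgen_deg_ge t : k%:Z <= rgen_deg t.
Proof. by case: t => [s|] //=; case: ifP. Qed.

Lemma rgenP t : U_deg G (rgen_deg t) (rgen t).
Proof.
case: t => [s|] /=; last exact: shift_deg.
by case: ifP => _; [apply/U_deg_limC/monomial_deg|apply: U_deg0].
Qed.

Local Notation rspan := (right_span G rgen rgen_deg).

(** The first k modes of [s] form a generator, and the remaining ones go into the coefficient. The
    prefix has degree >= k: it is either all of [s] or consists of k modes of degree >= 1 each. *)
Lemma rspan_small_parts c s : all (@mode_neg n) s ->
  all (fun g => - (2 * k)%:Z < g.2) s -> k%:Z <= sdeg s ->
  rspan (sdeg s) (lim (mon c s)).
Proof.
move=> sneg ssmall sk; pose s1 := take k s.
pose e (g : I) : 'I_n * 'I_(2 * k) := (g.1, inord `|g.2|%N).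
have size1 : (size (map e s1) <= k)%N by rewrite size_map size_take; case: ltnP => // /ltnW.
have neg1 : neg_word (Bseq size1) = s1.
  rewrite /= /neg_word -map_comp map_id_in // => -[i a] /mem_take as1 /=.
  have := allP sneg _ as1; have := allP ssmall _ as1; rewrite /mode_neg /= => a1 a2.
  congr pair; rewrite inordK; first by lia.
  by change (`|a| < 2 * k)%N; lia.
have deg1 : k%:Z <= sdeg s1.
  have [ks|sk'] := leqP (size s) k; first by rewrite /s1 take_oversize.
  have : (size s1)%:Z <= sdeg s1.
    have : all (@mode_neg n) s1 by apply/allP => g /mem_take/(allP sneg).
    elim: (s1) => [|g s2 IHs] /=; first by rewrite sdeg_nil.
    by case/andP; rewrite /mode_neg sdeg_cons => g0 /IHs; lia.
  by rewrite size_take sk'.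
have := @right_span_gen _ _ G _ rgen rgen_deg (Some (Bseq size1)) (sdeg (drop k s))
  (lim (mon c (drop k s))) (U_deg_limC L (monomial_deg _ _)).
rewrite /rgen /rgen_deg neg1 deg1 -sdeg_cat cat_take_drop -limCM (@monomialM R n).
by rewrite mul1r cat_take_drop.
Qed.

(** Strong induction on b. For b < 2 k the mode is a generator. Otherwise b = k + c with c >= k, and
    H_i t^(- b) = D H_i t^(- c) - H_i t^(- c) D, where D is a generator and H_i t^(- c) is in the
    right ideal by induction. *)
Lemma rspan_one i (b : nat) : (k <= b)%N ->
  rspan b%:Z (lim (mon 1 [:: (i, - b%:Z)])).
Proof.
elim/ltn_ind: b => b IHb kb; have [b2|b2] := ltnP b (2 * k).
  have e : sdeg [:: (i, - b%:Z)] = b%:Z by rewrite sdeg_cons sdeg_nil /=; lia.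
  rewrite -[X in rspan X]e; apply: rspan_small_parts; rewrite ?all_seq1 ?e.
  - by rewrite /mode_neg /=; lia.
  - by change (- (2 * k)%:Z < - b%:Z); lia.
  - by lia.
have [c bc] : exists c, b = (k + c)%N by exists (b - k)%N; lia.
subst b.
have c0 : (0 < c)%N by lia.
have dc : U_deg G c%:Z (lim (mon 1 [:: (i, - c%:Z)])).
  have e : sdeg [:: (i, - c%:Z)] = c%:Z by rewrite sdeg_cons sdeg_nil /=; lia.
  by rewrite -[X in U_deg _ X]e; exact/U_deg_limC/monomial_deg.
rewrite -(shift_comm i c0); apply: right_spanD.
  exact: (@right_span_gen _ _ G _ rgen rgen_deg None c%:Z _ dc).
rewrite -mulrN PoszD addrC; apply: right_spanM; last exact/U_degN/shift_deg.
by apply: IHb; lia.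
Qed.

(** Negative modes commute, so a mode H_i t^(- b) with b >= 2 k can be moved to the front, where
    [rspan_one] applies to it. *)
Lemma rspan_neg c s : all (@mode_neg n) s -> k%:Z <= sdeg s ->
  rspan (sdeg s) (lim (mon c s)).
Proof.
move=> sneg sk; case: (boolP (all (fun g => - (2 * k)%:Z < g.2) s)) => [h|].
  exact: rspan_small_parts.
case/allPn => -[i a] ias /= ; rewrite -leNgt => a2.
have hs := perm_to_rem ias.
have -> : mon c s = mon c ((i, a) :: rem (i, a) s).
  have := @monomial_perm R n _ c [::] _ _ [::] (@mode_neg_comm n) sneg hs.
  by rewrite !cats0.
have -> : sdeg s = - a + sdeg (rem (i, a) s).
  by rewrite /sdeg (perm_big _ hs) big_cons.
have -> : (i, a) = (i, - `|a|%N%:Z) by congr pair; lia.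
rewrite -[_ :: _]cat1s -[c]mul1r -(@monomialM R n) limCM.
apply: right_spanM; last exact/U_deg_limC/monomial_deg.
have -> : - a = `|a|%N%:Z by lia.
apply: rspan_one; lia.
Qed.

(** In a normally ordered word of degree m the annihilation modes have degree <= 0, so the creation
    part in front has degree >= m >= k and [rspan_neg] applies. *)
Lemma rspan_deg m w : k%:Z <= m -> G m w -> rspan m (lim w).
Proof.
move=> km /normal_deg; move: w; apply: addspan_min => [|x y|].
- by rewrite (_ : lim 0 = 0) //; apply: right_span0.
- by rewrite limCD; apply: right_spanD.
move=> _ [c [s1 [s2 [s3 [h1 h2 h3 hm ->]]]]].
have s3neg : sdeg s3 <= 0.
  elim: (s3) h3 => [|g s IHs] /=; first by rewrite sdeg_nil.
  by case/andP; rewrite /mode_pos sdeg_cons => g0 /IHs; lia.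
rewrite -[c]mulr1 -(@monomialM R n) limCM (_ : m = sdeg s1 + sdeg (s2 ++ s3)); last first.
  by rewrite sdeg_cat (sdeg_zero h2) add0r.
apply: right_spanM; last exact/U_deg_limC/monomial_deg.
by apply: rspan_neg => //; lia.
Qed.

(** The left factor [w] has degree a >= k and is expanded in the generators; the mode H_i t^a is
    multiplied into the coefficients and makes them vanish in the component [N]. *)
Lemma small_mode N w i (a : int) : k%:Z <= a -> N%:Z <= a -> G a w ->
  small_span G rgen rgen_deg N (lim (w * mode (@Umon R n) i a)).
Proof.
move=> ka Na hw; rewrite limCM.
apply: small_spanM (rspan_deg ka hw) _ _; last by apply/lpi_eq0/mode_left_gen.
apply: U_deg_limC; rewrite (@mode_monomial R n).
have -> : - a = sdeg [:: (i, a)] by rewrite sdeg_cons sdeg_nil /= addr0.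
exact: monomial_deg.
Qed.

End RightGenerators.

(** * Homogeneous components *)

Section HomogeneousParts.
Import monalg mpoly.
Variables (R : realType) (n : nat).
Local Notation C := R[i].
Local Notation word := {fmonom ('I_n * int)%type}.
Local Notation F := {malg C[{fmonom ('I_n * int)%type}]}.
Implicit Types (x y : F) (w : word) (m e : int).

Definition homogeneous m x := forall w, w \in monalg.msupp x -> word_deg w = m.

(* The relations being homogeneous, this induces a projection on [Uheis]. *)
Definition hom_part m x : F :=
  [malg w in monalg.msupp x => if word_deg w == m then monalg.mcoeff w x else 0].

Lemma hom_partE m x w :
  monalg.mcoeff w (hom_part m x) = if word_deg w == m then monalg.mcoeff w x else 0.
Proof. by rewrite mcoeffE; case: msuppP => //; rewrite if_same. Qed.

Lemma hom_partB m x y : hom_part m (x - y) = hom_part m x - hom_part m y.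
Proof.
apply/malgP => w; rewrite monalg.mcoeffB !hom_partE monalg.mcoeffB.
by case: ifP; rewrite ?subr0.
Qed.

Lemma hom_partD m x y : hom_part m (x + y) = hom_part m x + hom_part m y.
Proof.
apply/malgP => w; rewrite monalg.mcoeffD !hom_partE monalg.mcoeffD.
by case: ifP; rewrite ?addr0.
Qed.

Lemma hom_part0 m : hom_part m 0 = 0.
Proof. by apply/malgP => w; rewrite hom_partE monalg.mcoeff0 if_same. Qed.

Lemma hom_part_homogeneous m e x :
  homogeneous e x -> hom_part m x = if e == m then x else 0.
Proof.
move=> hx; apply/malgP => w; rewrite hom_partE.
have [/hx ->|wx] := boolP (w \in monalg.msupp x).
  by case: ifP => // _; rewrite monalg.mcoeff0.
rewrite (monalg.mcoeff_outdom wx) if_same.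
by case: ifP => _; rewrite ?monalg.mcoeff0 // (monalg.mcoeff_outdom wx).
Qed.

Lemma homogeneous_mon c w : homogeneous (word_deg w) (hmon c w).
Proof. by move=> v /(fsubsetP msuppU_le); rewrite inE => /eqP ->. Qed.

Lemma homogeneous0 m : homogeneous m 0.
Proof. by move=> w; rewrite monalg.msupp0. Qed.

Lemma homogeneousD m x y : homogeneous m x -> homogeneous m y -> homogeneous m (x + y).
Proof.
by move=> hx hy w /(fsubsetP (monalg.msuppD_le _ _)); rewrite inE => /orP[/hx|/hy].
Qed.

Lemma homogeneousN m x : homogeneous m x -> homogeneous m (- x).
Proof. by move=> hx w; rewrite monalg.msuppN; apply: hx. Qed.

Lemma homogeneousM m e x y :
  homogeneous m x -> homogeneous e y -> homogeneous (m + e) (x * y).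
Proof.
move=> hx hy w /monalg.msuppM_le [u [v [/hx <- /hy <- ->]]].
by rewrite /word_deg fmM big_cat.
Qed.

End HomogeneousParts.

(* The operations of [hfree] are those of [malg] only up to unfolding, hence the
   restatements. *)
Section HomogeneousFree.
Import monalg mpoly.
Variables (R : realType) (n : nat).
Local Notation C := R[i].
Local Notation H := (hfree R n).
Local Notation word := {fmonom ('I_n * int)%type}.
Implicit Types (x y : H) (w : word) (m e : int).

Let hD m x y : homogeneous m x -> homogeneous m y -> homogeneous m (x + y).
Proof. exact: homogeneousD. Qed.
Let hN m x : homogeneous m x -> homogeneous m (- x).
Proof. exact: homogeneousN. Qed.
Let hM m e x y : homogeneous m x -> homogeneous e y -> homogeneous (m + e) (x * y).
Proof. exact: homogeneousM. Qed.
Let h0 m : homogeneous m (0 : H).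
Proof. exact: homogeneous0. Qed.
Let partD m x y : hom_part m (x + y) = (hom_part m x + hom_part m y : H).
Proof. exact: hom_partD. Qed.
Let partB m x y : hom_part m (x - y) = (hom_part m x - hom_part m y : H).
Proof. exact: hom_partB. Qed.
Let part0 m : hom_part m (0 : H) = (0 : H).
Proof. exact: hom_part0. Qed.
Let part_hom m e x : homogeneous e x -> hom_part m x = if e == m then x else (0 : H).
Proof. exact: hom_part_homogeneous. Qed.
Let decomp x : x = \sum_(w <- monalg.msupp (x : {malg C[word]}))
  (hmon (monalg.mcoeff w (x : {malg C[word]})) w : H).
Proof. exact: monalgE. Qed.

Lemma homogeneous_gen i a : homogeneous (- a) (hgen R i a : H).
Proof.
have <- : word_deg (fmu (i, a)) = - a by rewrite /word_deg fmU big_seq1.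
exact: homogeneous_mon.
Qed.

Lemma homogeneous_int (z : int) : homogeneous 0 (z%:~R : H).
Proof.
have h1 : homogeneous 0 (1 : H).
  have <- : word_deg (mone : word) = 0 by rewrite /word_deg fm1 big_nil.
  exact: homogeneous_mon.
have hn (q : nat) : homogeneous 0 (q%:R : H).
  elim: q => [|q IHq]; first exact: h0.
  by rewrite mulrSr; apply: hD.
by case: z => m; [exact: hn|apply/hN/hn].
Qed.

Lemma heis_rel_homogeneous x : heis_rel x -> exists m, homogeneous m x.
Proof.
case=> i [j [a [b ->]]]; exists (- (a + b)).
have hgg (i' j' : 'I_n) (a' b' : int) :
    homogeneous (- (a' + b')) (hgen R i' a' * hgen R j' b' : H).
  by rewrite opprD; apply: hM; apply: homogeneous_gen.
apply: hD; last apply: hN.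
  apply: hD; [exact: hgg|apply: hN].
  by rewrite [a + b]addrC; apply: hgg.
(* The constant term has degree 0, and it is present only when the commutator has degree 0 as
   well. *)
have [->|_] := eqVneq (a + b) 0; first by rewrite oppr0; apply: homogeneous_int.
by rewrite andbF; apply: h0.
Qed.

Lemma homogeneous_span x : addspan (fun y : H => exists m, homogeneous m y) x.
Proof.
rewrite [x]decomp; apply: big_ind => [|y z|w _]; first exact: addspan0.
  exact: addspanD.
apply: addspan_gen; exists (word_deg w); exact: homogeneous_mon.
Qed.

Definition heis_kernel (x : H) : Prop :=
  addspan (fun y : hfree R n => exists u r v, heis_rel r /\ y = u * r * v) x.

(** Splitting u and v in the elements u r v into homogeneous parts shows that the kernel is spanned
    by homogeneous elements, as [r] is homogeneous. The projection keeps or kills each of these. *)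
Lemma heis_kernel_part m x : heis_kernel x -> heis_kernel (hom_part m x).
Proof.
move=> hx; have : addspan (fun y : H => exists2 e, homogeneous e y & heis_kernel y) x.
  move: x hx; apply: addspan_min => [|x y hx hy|_ [u [r [v [hr ->]]]]].
  - exact: addspan0.
  - exact: addspanD.
  have [e he] := heis_rel_homogeneous hr.
  apply: (@addspanM (hfree R n) (fun y : H => exists2 e', homogeneous e' y &
    exists u', y = u' * r) (fun y : H => exists e', homogeneous e' y)) (homogeneous_span v).
    move=> x y [e1 he1 [u' xu]] [e2 he2]; exists (e1 + e2); first exact: hM.
    rewrite xu /heis_kernel; apply: addspan_gen.
    by exists u', r, y; exact: conj hr (erefl _).
  apply: (@addspanM (hfree R n) (fun y : H => exists e', homogeneous e' y)
                     (fun y : H => y = r))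
    (homogeneous_span u) (addspan_gen (erefl r)).
  by move=> x y [e1 he1] ->; exists (e1 + e); [exact: hM|exists x].
move: x {hx}; apply: addspan_min => [|x y hx hy|x [e he hx]].
- by rewrite part0; apply: addspan0.
- by rewrite partD; apply: addspanD.
rewrite (part_hom _ he); case: ifP => // _; exact: addspan0.
Qed.

Lemma Upi_part m x y : Upi R n x = Upi R n y ->
  Upi R n (hom_part m x) = Upi R n (hom_part m y).
Proof.
move/eqP; rewrite /Upi /presented_pi tspi_eq => /asboolP h.
apply/eqP; rewrite tspi_eq; apply/asboolP.
have := @heis_kernel_part m (x - y) h.
by rewrite partB.
Qed.

Lemma deg_lift m (w : Uheis R n) : heis_grading R n m w ->
  exists2 x : H, homogeneous m x & w = Upi R n x.
Proof.
move: w; apply: addspan_min => [|v w [x hx ->] [y hy ->]|_ [c [w [<- ->]]]].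
- by exists 0; [exact: h0|rewrite (rmorph0 (Upi R n))].
- by exists (x + y); [exact: hD|rewrite (rmorphD (Upi R n))].
by exists (hmon c w : H); first exact: homogeneous_mon.
Qed.

Definition filt_gen N (x : H) := exists2 e, homogeneous e x &
  exists (u : H) i a, [/\ N%:Z <= a, homogeneous (e + a) u & x = u * hgen R i a].

Lemma filt_lift N (w : Uheis R n) : w \in heis_filt R n N ->
  exists2 x : H, addspan (filt_gen N) x & w = Upi R n x.
Proof.
move=> /asboolP; move: w; apply: addspan_min => [|v w [x hx ->] [y hy ->]|].
- by exists 0; [exact: addspan0|rewrite (rmorph0 (Upi R n))].
- by exists (x + y); [exact: addspanD|rewrite (rmorphD (Upi R n))].
move=> _ [u [_ [_ [i [a [Na ->]]] ->]]]; have [u0 ->] := presented_piP u.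
exists (u0 * hgen R i a); last by rewrite (rmorphM (Upi R n)).
apply: (@addspanM (hfree R n) (fun y : H => exists e', homogeneous e' y)
                   (fun y : H => y = hgen R i a))
    (homogeneous_span u0) (addspan_gen (erefl _)).
move=> x y [e he] ->; exists (e - a).
  exact: (hM he (@homogeneous_gen i a)).
by exists x, i, a; rewrite subrK.
Qed.

Lemma homogeneous_deg m x : homogeneous m x -> heis_grading R n m (Upi R n x).
Proof.
move=> hx; rewrite [x]decomp (big_morph (Upi R n) (rmorphD _) (rmorph0 _)).
rewrite big_seq; apply: big_ind => [|u v|w /hx <-]; [exact: gr_deg0|exact: gr_degD|].
by apply: addspan_gen; exists (monalg.mcoeff w x), w.
Qed.

(** Membership in the left ideal gives cofactors of no particular degree. Lifting to the free
    algebra and projecting to degree m makes them homogeneous, as [small_mode] requires. *)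
Lemma filt_deg N m (w : Uheis R n) : heis_grading R n m w -> w \in heis_filt R n N ->
  addspan (fun x : Uheis R n => exists i a v, [/\ N%:Z <= a, heis_grading R n (m + a) v &
                                      x = v * mode (@Umon R n) i a]) w.
Proof.
move=> /deg_lift [x hx ->] /filt_lift [y hy] xy.
have /(Upi_part m) := xy; rewrite (part_hom _ hx) eqxx => ->.
clear xy; move: y hy; apply: addspan_min => [|u v hu hv|y [e hu [u [i [a [Na ha eu]]]]]].
- by rewrite part0 (rmorph0 (Upi R n)); apply: addspan0.
- by rewrite partD (rmorphD (Upi R n)); apply: addspanD.
rewrite (part_hom _ hu); case: eqP => [<-|_]; last first.
  by rewrite (rmorph0 (Upi R n)); apply: addspan0.
apply: addspan_gen; exists i, a, (Upi R n u); split=> //.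
  exact: homogeneous_deg.
by rewrite eu (rmorphM (Upi R n)).
Qed.

End HomogeneousFree.

(** * Labeled partitions *)

Section PartitionBasis.
Variables (n m : nat).
Local Notation X := ('I_n * nat)%type.
Local Notation LP := (n.-tuple (m.-bseq 'I_m.+1)).
Implicit Types (t : LP) (s : seq X).

Definition part_list t : seq X :=
  [seq (i, val a) | i <- enum 'I_n, a <- tnth t i].

Lemma part_list_mult t i a :
  mult (part_list t) (i, a) = count_mem a (map val (tnth t i)).
Proof.
rewrite /mult /part_list count_flatten -map_comp sumnE big_map.
rewrite (bigD1_seq i) ?mem_enum ?enum_uniq //= big1 ?addn0 => [|j /negPf ji].
  by rewrite !count_map; apply: eq_count => x; rewrite /= xpair_eqE eqxx.
rewrite count_map; apply/eqP; rewrite -leqn0 leqNgt -has_count -all_predC.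
by apply/allP => x _; rewrite /= xpair_eqE ji.
Qed.

Lemma weight_part_list t :
  weight (part_list t) = (\sum_(s <- t) sumn (map val s))%N.
Proof.
rewrite /weight /part_list big_flatten big_map big_enum /= big_tuple.
by apply: eq_bigr => i _; rewrite big_map sumnE big_map.
Qed.

Lemma part_list_P t : t \in labeled_partitions n m ->
  positive (part_list t) /\ weight (part_list t) = m.
Proof.
rewrite inE weight_part_list => /andP[/allP ht /eqP->]; split=> //.
apply/allP => x /allpairsPdep [i [a [_ ai ->]]] /=.
have /andP[_ h0] := ht _ (mem_tnth i t); rewrite lt0n.
by apply: contraNneq h0 => <-; apply: map_f.
Qed.

Lemma geq_trans : transitive geq.
Proof. by move=> a b c ba ac; apply: leq_trans ac ba. Qed.

Lemma geq_anti : antisymmetric geq.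
Proof. by move=> a b; rewrite /= andbC => /anti_leq. Qed.

Lemma geq_total : total geq.
Proof. by move=> a b; rewrite /= leq_total. Qed.

(** For each label the multiplicities determine the parts up to order, and a weakly decreasing list
    is determined by its multiset. *)
Lemma part_list_inj t t' : t \in labeled_partitions n m ->
  t' \in labeled_partitions n m -> mult (part_list t) = mult (part_list t') -> t = t'.
Proof.
rewrite !inE => /andP[/allP ht _] /andP[/allP ht' _] tt'; apply: eq_from_tnth => i.
apply/val_inj/(inj_map val_inj).
have /andP[st _] := ht _ (mem_tnth i t); have /andP[st' _] := ht' _ (mem_tnth i t').
apply: (sorted_eq geq_trans geq_anti st st').
apply/allP => a _ /=; apply/eqP.
by rewrite -!part_list_mult tt'.
Qed.

Lemma sumn_ge_size (s : seq nat) : 0%N \notin s -> (size s <= sumn s)%N.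
Proof.
by elim: s => //= a s IHs; rewrite inE negb_or => /andP[a0 /IHs]; lia.
Qed.

Lemma sumn_ge_mem (s : seq nat) a : a \in s -> (a <= sumn s)%N.
Proof. by elim: s => //= b s IHs; rewrite inE => /orP[/eqP->|/IHs]; lia. Qed.

Definition label_parts s (i : 'I_n) : seq nat :=
  sort geq [seq e.2 | e <- s & e.1 == i].

Lemma label_parts0 s i : positive s -> 0%N \notin label_parts s i.
Proof.
move=> /allP ps; rewrite mem_sort; apply/mapP => -[e].
by rewrite mem_filter => /andP[_ /ps] + e0; rewrite -e0.
Qed.

Lemma sumn_label_parts s : (\sum_(i < n) sumn (label_parts s i) = weight s)%N.
Proof.
transitivity (\sum_(i < n) \sum_(e <- s | e.1 == i) e.2)%N.
  apply: eq_bigr => i _; rewrite (perm_sumn (permEl (perm_sort _ _))) sumnE big_map.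
  by rewrite big_filter.
rewrite (exchange_big_dep xpredT) //=; apply: eq_bigr => e _.
by rewrite (big_pred1 e.1) // => i; rewrite eq_sym.
Qed.

Lemma part_list_surj s : positive s -> weight s = m ->
  exists2 t, t \in labeled_partitions n m & mult (part_list t) = mult s.
Proof.
move=> ps ws.
(* The parts are positive, so both their number and their size are at most m: they fit into the
   bounded sequences, and [inord] does not alter them. *)
have sum_le i : (sumn (label_parts s i) <= m)%N.
  by rewrite -ws -sumn_label_parts (bigD1 i) //= leq_addr.
have size_le i : (size (map (@inord m) (label_parts s i)) <= m)%N.
  by rewrite size_map (leq_trans (sumn_ge_size (label_parts0 i ps))).
have val_parts i : map val (Bseq (size_le i)) = label_parts s i.
  rewrite -map_comp map_id_in // => a /sumn_ge_mem/leq_trans/(_ (sum_le i)) am.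
  by rewrite /= inordK.
pose t : LP := [tuple Bseq (size_le i) | i < n].
have tE i : map val (tnth t i) = label_parts s i by rewrite tnth_mktuple val_parts.
exists t.
  rewrite inE; apply/andP; split.
    apply/allP => _ /tnthP[i ->]; rewrite tE /is_part label_parts0 // andbT.
    exact: (sort_sorted geq_total).
  apply/eqP; rewrite -[RHS]ws -sumn_label_parts big_tuple.
  by apply: eq_bigr => i _; rewrite tE.
apply: funext => -[i a]; rewrite part_list_mult tE /mult /label_parts.
rewrite (permP (permEl (perm_sort _ _))) count_map count_filter.
by apply: eq_count => -[j b]; rewrite /= xpair_eqE andbC.
Qed.

Definition basis (j : 'I_(num_labeled_partitions n m)) : seq X :=
  part_list (enum_val j).

Lemma basis_positive j : positive (basis j).
Proof. by have [] := part_list_P (enum_valP j). Qed.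

Lemma basis_weight j : weight (basis j) = m.
Proof. by have [] := part_list_P (enum_valP j). Qed.

Lemma basis_inj i j : mult (basis i) = mult (basis j) -> i = j.
Proof. by move/part_list_inj=> h; apply/enum_val_inj/h; apply: enum_valP. Qed.

Lemma basis_surj s : positive s -> weight s = m ->
  exists j, mult (basis j) = mult s.
Proof.
move=> ps /(part_list_surj ps) [t ht <-]; exists (enum_rank_in ht t).
by rewrite /basis enum_rankK_in.
Qed.

Lemma mult_perm s s' : mult s = mult s' -> perm_eq s s'.
Proof. by move=> e; apply/allP => x _; apply/eqP; have := congr1 (@^~ x) e. Qed.

End PartitionBasis.

(** * Matrix units *)

Section MatrixUnits.
Variables (R : realType) (n : nat).
Local Notation C := R[i].
Local Notation X := ('I_n * nat)%type.
Local Notation I := ('I_n * int)%type.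
Local Notation A := {mpoly C[n]}.
Local Notation V := (fock X A).
Local Notation W := (Uheis R n).
Local Notation mon := (@monomial R n).
Implicit Types (s t : seq X) (b : X -> nat) (c : C) (f : V).

(** A monomial. Multidegrees are functions, so their equality is decided classically. *)
Definition delta b : V := fun b' => (`[< b' = b >])%:R.

Lemma delta_same b : delta b b = 1.
Proof. by rewrite /delta asboolT ?mulr1n. Qed.

Lemma delta_diff b b' : b' <> b -> delta b b' = 0.
Proof. by move=> h; rewrite /delta asboolF ?mulr0n. Qed.

Lemma fock_deg_delta s : positive s -> fock_deg (weight s)%:Z (delta (mult s)).
Proof.
move=> ps b db; exists s; split=> //; apply: contrapT => /delta_diff.
exact: db.
Qed.

Lemma up_delta e b : up_fun e (delta b) = delta (incr e b).
Proof.
apply: funext => b'; rewrite /up_fun /delta; case: eqP => [b0|/eqP b0].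
  rewrite asboolF ?mulr0n // => eb; move: b0.
  by rewrite eb /incr eqxx addn1.
congr (_%:R); congr nat_of_bool; apply/asboolP/asboolP => [<-|->].
  by rewrite incr_decr.
by rewrite decr_incr.
Qed.

Lemma down_delta e b : down_fun e (delta b) = (fun b' => (b e)%:R * delta (decr e b) b').
Proof.
apply: funext => b'; rewrite /down_fun; have [eb|neb] := pselect (incr e b' = b).
  rewrite -eb decr_incr !delta_same; congr (_%:R * _).
  by rewrite /incr eqxx addn1.
rewrite (delta_diff neb) mulr0; have [->|b0] := eqVneq (b e) 0%N.
  by rewrite mul0r.
rewrite delta_diff ?mulr0 // => eb'; apply: neb.
by rewrite eb' incr_decr.
Qed.

Definition neg_modes s : seq I := [seq (e.1, - (e.2)%:Z) | e <- s].
(* Reversed, so that the head of [s] acts first. *)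
Definition pos_modes s : seq I := rev [seq (e.1, (e.2)%:Z) | e <- s].
Definition zero_modes (p : 'X_{1..n}) : seq I :=
  flatten [seq nseq (p i) (i, 0) | i <- enum 'I_n].

Lemma act_monomial c (s : seq I) f :
  act (mon c s) f = fun b => c%:MP * act (mon 1 s) f b.
Proof.
rewrite -[c in LHS]mulr1 -[s in LHS]cat0s -(@monomialM R n) actM.
rewrite {1}/act /monomial fock_act_mon /word_op big_nil mulr1.
exact: erefl.
Qed.

Lemma act_cat (s t : seq I) f : act (mon 1 (s ++ t)) f = act (mon 1 s) (act (mon 1 t) f).
Proof.
have e : mon 1 (s ++ t) = mon 1 s * mon 1 t by rewrite (@monomialM R n) mulr1.
by rewrite e actM.
Qed.

Lemma act_nil f : act (mon 1 [::]) f = f.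
Proof. by rewrite (@monomial1 R n) act1. Qed.

Lemma act_cons g (s : seq I) f :
  act (mon 1 (g :: s)) f = end_app (mode_op R g) (act (mon 1 s) f).
Proof. by rewrite -cat1s act_cat; case: g => i a; rewrite -(@mode_monomial R n) act_mode. Qed.

Lemma actZ (w : W) (p : A) f : act w (fun b => p * f b) = fun b => p * act w f b.
Proof. exact: fock_funZ. Qed.

Lemma act_neg_modes s : positive s ->
  act (mon 1 (neg_modes s)) (delta (mult [::])) = delta (mult s).
Proof.
elim: s => [_|[i [|a]] s IHs //= ps]; first by rewrite act_nil.
by rewrite act_cons IHs //= mult_cons -up_delta.
Qed.

Lemma act_zero_modes p f : act (mon 1 (zero_modes p)) f = fun b => 'X_[p] * f b.
Proof.
rewrite mpolyXE_id /zero_modes -big_enum /=.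
elim: (enum 'I_n) => [|i s IHs] /=.
  by rewrite act_nil; apply: funext => b; rewrite big_nil mul1r.
rewrite act_cat IHs big_cons.
elim: (p i) => [|k IHk] /=.
  by rewrite act_nil; apply: funext => b; rewrite expr0 mul1r.
by rewrite act_cons IHk; apply: funext => b; rewrite /= exprS -!mulrA.
Qed.

(** This is \prod_e a_e^(m_e) m_e! over the distinct variables e = (i, a_e) of [s], with m_e the
    multiplicity; for n = 1 it is the order of the centralizer of a permutation of cycle type
    [s]. *)
Fixpoint pos_const s : nat :=
  if s is e :: s' then (e.2 * (count_mem e s').+1 * pos_const s')%N else 1%N.

Lemma pos_const_gt0 s : positive s -> (0 < pos_const s)%N.
Proof. by elim: s => //= e s IHs /andP[e0 /IHs h]; rewrite !muln_gt0 e0 h. Qed.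

(** The head e of [s] acts first, as a multiple of a derivation: it kills the monomial of [t] unless
    e occurs in it, and otherwise removes one copy of e. As the weights agree, [t] is used up
    exactly when [s] is. *)
Lemma act_pos_modes s t : positive s -> positive t -> weight t = weight s ->
  act (mon 1 (pos_modes s)) (delta (mult t)) =
  fun b => (if `[< mult t = mult s >] then (pos_const s)%:R else 0)
             * delta (mult [::]) b.
Proof.
elim: s t => [|[i a] s IHs] t ps pt wt.
  have t0 : t = [::].
    case: t pt wt => // e t /= /andP[e0 _]; rewrite weight_cons /weight big_nil.
    by move: e0; lia.
  rewrite t0 act_nil; apply: funext => b.
  by case: asboolP => // _; rewrite mul1r.
rewrite /pos_modes map_cons rev_cons -cats1 act_cat act_cons act_nil.
case: a ps wt => [//|a] ps wt; rewrite /mode_op /= end_appMn.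
set e := (i, a.+1).
have -> : (fun b => end_app (down A (i, a.+1)) (delta (mult t)) b *+ a.+1) =
    (fun b => (a.+1 * mult t e)%:R * delta (decr e (mult t)) b).
  apply: funext => b; rewrite -[end_app _ _]/(down_fun e (delta (mult t))) down_delta.
  by rewrite -mulrnAl -mulrnA mulnC.
rewrite actZ.
have [et|et] := boolP (e \in t); last first.
  have -> : mult t e = 0%N by apply/count_memPn.
  apply: funext => b; rewrite muln0 mul0r; case: asboolP => [ts|_].
    by move: et; rewrite (perm_mem (mult_perm ts)) mem_head.
  by rewrite mul0r.
rewrite -mult_rem // IHs; last first.
- by move: wt; rewrite (weight_rem et) weight_cons /=; lia.
- exact: positive_rem.
- by [].
apply: funext => b; rewrite mulrA; congr (_ * _).
case: asboolP => [ts|ts]; case: asboolP => [ts'|ts'].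
- by rewrite -natrM ts' /mult /= eqxx add1n.
- case: ts'; rewrite mult_cons -ts mult_rem // incr_decr // -lt0n -has_count has_pred1 //.
- by case: ts; rewrite mult_rem // ts' mult_cons decr_incr.
by rewrite mulr0.
Qed.

End MatrixUnits.

(** * Matrices of the action on one graded part *)

Module Block.
Section Blocks.
Variables (R : realType) (n m : nat).
Local Notation C := R[i].
Local Notation X := ('I_n * nat)%type.
Local Notation I := ('I_n * int)%type.
Local Notation A := {mpoly C[n]}.
Local Notation V := (fock X A).
Local Notation W := (Uheis R n).
Local Notation G := (heis_grading R n).
Local Notation mon := (@monomial R n).
Local Notation N := (num_labeled_partitions n m).
Implicit Types (v w : W) (f : V) (i j : 'I_N) (p q : A) (P : 'M[A]_N) (c : C).

Definition vec j : V := delta R (mult (basis j)).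

Definition rep w : 'M[A]_N := \matrix_(i, j) act w (vec j) (mult (basis i)).

Lemma vec_deg j : fock_deg m%:Z (vec j).
Proof. by rewrite -{1}(basis_weight j); apply/fock_deg_delta/basis_positive. Qed.

Lemma rep_is_zmod_morphism : zmod_morphism rep.
Proof. by move=> v w; apply/matrixP => i j; rewrite !mxE actB. Qed.
HB.instance Definition _ := GRing.isZmodMorphism.Build W 'M[A]_N rep
  rep_is_zmod_morphism.

Lemma fock_deg_expand f : fock_deg m%:Z f ->
  f = fun b => \sum_j f (mult (basis j)) * vec j b.
Proof.
move=> hf; apply: funext => b.
have [[j ->]|nb] := pselect (exists j, b = mult (basis j)).
  rewrite (bigD1 j) //= /vec delta_same mulr1 big1 ?addr0 // => i ij.
  rewrite delta_diff ?mulr0 // => /basis_inj ji.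
  by rewrite ji eqxx in ij.
rewrite big1 => [|j _]; last first.
  by rewrite /vec delta_diff ?mulr0 // => e; apply: nb; exists j.
have [//|/eqP/hf [s [ps [ws] eb]]] := eqVneq (f b) 0.
by have [j ej] := basis_surj ps ws; case: nb; exists j; rewrite eb ej.
Qed.

(** With the right factor of degree 0, the image of a basis vector is again a combination of basis
    vectors of weight m, to which [v] can be applied. *)
Lemma rep_mul v w : G 0 w -> rep (v * w) = rep v *m rep w.
Proof.
move=> hw; apply/matrixP => i j; rewrite !mxE actM.
have := act_deg hw (@vec_deg j); rewrite addr0 => /fock_deg_expand ->.
rewrite /act /end_app fock_fun_sum; apply: eq_bigr => k _.
rewrite !mxE fock_funZ mulrC; congr (_ * _).
Qed.

Lemma rep_act0 w : (forall f, fock_deg m%:Z f -> act w f = (fun=> 0)) -> rep w = 0.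
Proof. by move=> h; apply/matrixP => i j; rewrite !mxE h //; apply: vec_deg. Qed.

Lemma rep1 : rep 1 = 1%:M.
Proof.
apply/matrixP => i j; rewrite !mxE act1 /vec /delta; congr (_%:R); congr nat_of_bool.
by apply/asboolP/eqP => [/basis_inj|->].
Qed.

(** On the part of degree m the annihilation monomial of j selects the basis vector j and sends it
    to a multiple of the vacuum, the zero modes multiply by a monomial in the h_i, and the creation
    monomial of i produces the basis vector i. *)
Definition unit_word (i j : 'I_N) (u : 'X_{1..n}) : seq I :=
  neg_modes (basis i) ++ zero_modes u ++ pos_modes (basis j).

Lemma rep_unit c i j u : rep (mon c (unit_word i j u)) =
  (c%:MP * 'X_[u] * (pos_const (basis j))%:R) *: delta_mx i j.
Proof.
apply/matrixP => k l; rewrite !mxE act_monomial /unit_word 2!act_cat.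
rewrite /vec act_pos_modes ?basis_positive ?basis_weight //.
rewrite act_zero_modes !actZ act_neg_modes ?basis_positive // -!mulrA.
congr (_ * (_ * _)).
have -> : `[< mult (basis l) = mult (basis j) >] = (l == j).
  by apply/asboolP/eqP => [/basis_inj|->].
have -> : delta R (mult (basis i)) (mult (basis k)) = (k == i)%:R.
  rewrite /delta; congr (_%:R); congr nat_of_bool.
  by apply/asboolP/eqP => [/basis_inj|->].
by case: (l == j); rewrite ?andbT ?andbF ?mul0r ?mulr0.
Qed.

Definition block (w : W) : Prop :=
  addspan (fun w => exists c i j u, w = mon c (unit_word i j u)) w.

Lemma sdeg_neg_modes (s : seq X) : sdeg (neg_modes s) = (weight s)%:Z.
Proof.
elim: s => [|e s IHs]; first by rewrite sdeg_nil /weight big_nil.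
by rewrite /= sdeg_cons IHs weight_cons /= opprK.
Qed.

Lemma sdeg_pos_modes (s : seq X) : sdeg (pos_modes s) = - (weight s)%:Z.
Proof.
rewrite /pos_modes; elim: s => [|e s IHs]; first by rewrite sdeg_nil /weight big_nil.
by rewrite /= rev_cons -cats1 sdeg_cat IHs sdeg_cons sdeg_nil weight_cons /=; lia.
Qed.

Lemma all_zero_modes u : all (@mode_zero n) (zero_modes u).
Proof.
apply/allP => g /flatten_mapP[i _]; rewrite mem_nseq => /andP[_ /eqP ->].
by rewrite /mode_zero.
Qed.

Lemma block_deg w : block w -> G 0 w.
Proof.
move: w; apply: addspan_min => [|v w|_ [c [i [j [u ->]]]]]; first exact: gr_deg0.
  exact: gr_degD.
have -> : 0 = sdeg (unit_word i j u).
  rewrite !sdeg_cat sdeg_neg_modes sdeg_pos_modes !basis_weight.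
  by rewrite (sdeg_zero (all_zero_modes u)); lia.
exact: monomial_deg.
Qed.

(** The annihilation part lowers the degree by m > k. This is the triangularity of the action. *)
Lemma block_act k w f : block w -> (k < m)%N -> fock_deg k%:Z f -> act w f = (fun=> 0).
Proof.
move=> hw km hf; move: w hw.
apply: addspan_min => [|v w hv hw|_ [c [i [j [u ->]]]]]; first exact: act0.
  by rewrite actD hv hw; apply: funext => b; rewrite addr0.
rewrite act_monomial 2!act_cat; apply: funext => b.
have /fock_deg_neg -> : fock_deg (k%:Z - m%:Z) (act (mon 1 (pos_modes (basis j))) f).
- have <- : sdeg (pos_modes (basis j)) = - m%:Z by rewrite sdeg_pos_modes basis_weight.
  by apply: act_deg hf; apply: monomial_deg.
- by rewrite !act_fun0 mulr0.
by rewrite subr_lt0 ltz_nat.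
Qed.

(** The three supports are enlarged to a common list, which is harmless because [F u 0 = 0]. *)
Lemma sum_msupp_zmod (F : 'X_{1..n} -> C -> W) :
  (forall u, zmod_morphism (F u)) ->
  zmod_morphism (fun p : A => \sum_(u <- msupp p) F u p@_u).
Proof.
move=> FB p q; pose s := undup (msupp p ++ msupp q ++ msupp (p - q)).
have F0 u : F u 0 = 0 by rewrite -(subrr 0) FB subrr.
have wide r : {subset msupp r <= s} ->
    \sum_(u <- msupp r) F u r@_u = \sum_(u <- s) F u r@_u.
  move=> rs; rewrite [RHS](bigID (mem (msupp r))) /= [X in _ + X]big1 ?addr0.
    rewrite -[RHS]big_filter; apply: perm_big; apply: uniq_perm.
    - exact: msupp_uniq.
    - by rewrite filter_uniq ?undup_uniq.
    by move=> u; rewrite mem_filter; case: (boolP (u \in msupp r)) => // /rs ->.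
  by move=> u /memN_msupp_eq0 ->.
rewrite !wide; try by move=> u us; rewrite mem_undup !mem_cat us ?orbT.
by rewrite -sumrB; apply: eq_bigr => u _; rewrite mcoeffB FB.
Qed.

Definition lift_entry (i j : 'I_N) (p : A) : W :=
  \sum_(u <- msupp p) mon (p@_u / (pos_const (basis j))%:R) (unit_word i j u).

Lemma lift_entry_zmod i j : zmod_morphism (lift_entry i j).
Proof.
apply: (@sum_msupp_zmod (fun u c => mon (c / (pos_const (basis j))%:R) (unit_word i j u))).
move=> u c c'; rewrite mulrBl (@monomialD R n) (@monomialN R n) //.
Qed.

(** With the constants of [rep_unit] divided out in [lift_entry], this is the inverse of [rep] on
    [block]; see [lift_mxK] and [rep_blockK]. *)
Definition lift_mx P : W := \sum_i \sum_j lift_entry i j (P i j).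

Lemma lift_mx_is_zmod_morphism : zmod_morphism lift_mx.
Proof.
move=> P Q; rewrite /lift_mx -sumrB; apply: eq_bigr => i _.
by rewrite -sumrB; apply: eq_bigr => j _; rewrite !mxE lift_entry_zmod.
Qed.
HB.instance Definition _ := GRing.isZmodMorphism.Build 'M[A]_N W lift_mx
  lift_mx_is_zmod_morphism.

Lemma pos_const_neq0 j : (pos_const (basis j))%:R != 0 :> C.
Proof. by rewrite pnatr_eq0 -lt0n pos_const_gt0 // basis_positive. Qed.

Lemma lift_mx_block P : block (lift_mx P).
Proof.
do 3 (apply: big_ind => [|v w|? _]; [exact: addspan0|exact: addspanD|]).
by apply: addspan_gen; do 4 eexists.
Qed.

Lemma lift_mxK P : rep (lift_mx P) = P.
Proof.
rewrite /lift_mx raddf_sum [RHS]matrix_sum_delta; apply: eq_bigr => i _.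
rewrite raddf_sum; apply: eq_bigr => j _; rewrite /lift_entry raddf_sum.
rewrite [in RHS](mpolyE (P i j)) scaler_suml; apply: eq_bigr => u _.
rewrite /= rep_unit; congr (_ *: _).
rewrite mulrAC -mul_mpolyC; congr (_ * _).
rewrite -(mpolyC_nat n C (pos_const (basis j))) -mpolyCM.
by rewrite divfK // pos_const_neq0.
Qed.

Lemma rep_blockK w : block w -> lift_mx (rep w) = w.
Proof.
move: w; apply: addspan_min => [|v w hv hw|_ [c [i [j [u ->]]]]].
- by rewrite !raddf0.
- by rewrite !raddfD /= hv hw.
rewrite rep_unit /lift_mx (bigD1 i) //= [X in _ + X]big1 ?addr0; last first.
  move=> k /negPf ki; apply: big1 => l _.
  by rewrite !mxE ki mulr0 /lift_entry msupp0 big_nil.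
rewrite (bigD1 j) //= [X in _ + X]big1 ?addr0; last first.
  move=> l /negPf lj.
  by rewrite !mxE lj andbF mulr0 /lift_entry msupp0 big_nil.
rewrite !mxE !eqxx mulr1 mulrAC -(mpolyC_nat n C (pos_const (basis j))).
rewrite -mpolyCM /lift_entry.
have [->|c0] := eqVneq c 0.
  by rewrite mul0r mpolyC0 mul0r msupp0 big_nil (@monomial0 R n).
have cp0 := mulf_neq0 c0 (pos_const_neq0 j).
rewrite mul_mpolyC (perm_big _ (msuppZ _ cp0)) msuppX big_seq1 mcoeffZ mcoeffX.
by rewrite eqxx mulr1 mulfK // pos_const_neq0.
Qed.

End Blocks.

End Block.
Import Block.

(** * The isomorphism *)

Module Level.
Section LevelQuotient.
Variables (R : realType) (n d : nat).
Local Notation C := R[i].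
Local Notation X := ('I_n * nat)%type.
Local Notation I := ('I_n * int)%type.
Local Notation A := {mpoly C[n]}.
Local Notation W := (Uheis R n).
Local Notation G := (heis_grading R n).
Local Notation L := (heis_filt R n).
Local Notation U := (invlim L).
Local Notation mon := (@monomial R n).
Local Notation lim := (limC L).
Local Notation mat m := 'M[A]_(num_labeled_partitions n m).
Local Notation repn m := (@rep R n m).

Lemma zero_modes_perm (s : seq I) : all (@mode_zero n) s ->
  perm_eq (zero_modes [multinom count_mem (i, 0 : int) s | i < n]) s.
Proof.
move=> /allP s0; apply/allP => -[j a] _; apply/eqP => /=.
rewrite /zero_modes count_flatten -map_comp sumnE big_map.
rewrite (bigD1_seq j) ?mem_enum ?enum_uniq //= big1 ?addn0 => [|i /negPf ij].
  rewrite count_nseq /= xpair_eqE eqxx mnmE /=.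
  have [<-|a0] := eqVneq 0 a; first by rewrite mul1n.
  rewrite mul0n; apply/esym/count_memPn/negP => /s0.
  by rewrite /mode_zero /= eq_sym (negPf a0).
by rewrite count_nseq /= xpair_eqE ij.
Qed.

(** Within each of the three groups the modes commute, so each can be permuted into the order used
    in [unit_word]. *)
Lemma normal_block m c (s1 s2 s3 : seq I) :
    all (@mode_neg n) s1 -> all (@mode_zero n) s2 -> all (@mode_pos n) s3 ->
    sdeg s1 = m%:Z -> sdeg s3 = - m%:Z ->
  block m (mon c (s1 ++ s2 ++ s3)).
Proof.
move=> h1 h2 h3 e1 e3.
pose t1 : seq X := [seq (g.1, `|g.2|%N) | g <- s1].
pose t3 : seq X := [seq (g.1, `|g.2|%N) | g <- rev s3].
have n1 : neg_modes t1 = s1.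
  rewrite /neg_modes -map_comp map_id_in // => -[i a] /(allP h1).
  by rewrite /mode_neg /= => a0; congr pair; lia.
have n3 : pos_modes t3 = s3.
  rewrite /pos_modes -map_comp map_id_in ?revK // => -[i a].
  rewrite mem_rev => /(allP h3).
  by rewrite /mode_pos /= => a0; congr pair; lia.
have p1 : positive t1.
  apply/allP => _ /mapP[g /(allP h1) + ->]; rewrite /mode_neg /=; lia.
have p3 : positive t3.
  apply/allP => e /mapP[g]; rewrite mem_rev => /(allP h3) + ->; rewrite /mode_pos /=; lia.
have [i /mult_perm pi] : exists i, mult (@basis n m i) = mult t1.
  by apply: basis_surj => //; move: e1; rewrite -n1 sdeg_neg_modes; lia.
have [j /mult_perm pj] : exists j, mult (@basis n m j) = mult t3.
  by apply: basis_surj => //; move: e3; rewrite -n3 sdeg_pos_modes; lia.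
apply: addspan_gen; exists c, i, j, [multinom count_mem (i, 0 : int) s2 | i < n].
rewrite /unit_word; set z := zero_modes _.
have e1' := @monomial_perm R n _ c [::] s1 (neg_modes (basis i)) (s2 ++ s3)
  (@mode_neg_comm n) h1.
rewrite -[LHS]/(mon c ([::] ++ s1 ++ s2 ++ s3)) e1'; last first.
  by rewrite -n1 /neg_modes; apply/perm_map; rewrite perm_sym.
have e2' := @monomial_perm R n (@mode_zero n) c (neg_modes (basis i)) s2 z s3
  (fun g h g0 _ => mode_zero_comm h g0) h2.
rewrite cat0s e2'; last by rewrite perm_sym; apply: zero_modes_perm.
have e3' := @monomial_perm R n _ c (neg_modes (basis i) ++ z) s3 (pos_modes (basis j)) [::]
  (@mode_pos_comm n) h3.
rewrite -!catA !cats0 in e3'; apply: e3'.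
rewrite -n3 /pos_modes perm_sym perm_rev perm_sym perm_rev.
by apply: perm_map; rewrite perm_sym.
Qed.

Definition high_words (x : W) := exists c s1 s2 s3,
  [/\ all (@mode_pos n) s3, sdeg s3 <= - d%:Z - 1,
      sdeg s1 + sdeg s2 + sdeg s3 = 0 & x = mon c (s1 ++ s2 ++ s3)].

(** In a normally ordered word of degree 0 the creation part has some degree m >= 0 and the
    annihilation part degree - m. The word belongs to the block m if m <= d and to the remainder
    otherwise. *)
Lemma normal_split w : G 0 w -> exists (v : nat -> W) r,
  [/\ forall m, block m (v m), addspan high_words r & w = \sum_(m < d.+1) v m + r].
Proof.
move/normal_deg; move: w; apply: addspan_min => [||].
- exists (fun=> 0), 0; split=> [m||]; [exact: addspan0|exact: addspan0|].
  by rewrite big1 // addr0.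
- move=> x y [v [r [hv hr ->]]] [v' [r' [hv' hr' ->]]].
  exists (fun m => v m + v' m), (r + r'); split=> [m||].
  + exact: addspanD (hv m) (hv' m).
  + exact: addspanD.
  by rewrite big_split addrACA.
move=> _ [c [s1 [s2 [s3 [h1 h2 h3 e ->]]]]].
have [m em] : exists m : nat, sdeg s1 = m%:Z.
  have : 0 <= sdeg s1.
    elim: (s1) h1 => [|g s IHs] /=; first by rewrite sdeg_nil.
    by case/andP; rewrite /mode_neg sdeg_cons => g0 /IHs; lia.
  by move=> h; exists `|sdeg s1|%N; lia.
have em3 : sdeg s3 = - m%:Z by lia.
have [md|dm] := ltnP m d.+1.
  exists (fun k => if k == m then mon c (s1 ++ s2 ++ s3) else 0), 0; split.
  - move=> k; case: eqP => [->|_]; last exact: addspan0.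
    exact: normal_block.
  - exact: addspan0.
  rewrite addr0 (bigD1 (Ordinal md)) //= eqxx big1 ?addr0 // => k.
  by rewrite -val_eqE => /= /negPf ->.
exists (fun=> 0), (mon c (s1 ++ s2 ++ s3)); split=> [k||].
- exact: addspan0.
- apply: addspan_gen; exists c, s1, s2, s3; split=> //; first by lia.
  by rewrite (sdeg_zero h2) addr0.
by rewrite big1 // add0r.
Qed.

Local Notation level := (prodspan (@U_gr _ L G) (@U_le _ L G (- d%:Z - 1))).

Lemma high_level r : addspan high_words r -> level (lim r).
Proof.
move: r; apply: addspan_min => [|x y|_ [c [s1 [s2 [s3 [h3 e3 e ->]]]]]].
- exact: addspan0.
- by rewrite limCD; apply: addspanD.
rewrite catA -[c]mulr1 -(@monomialM R n) limCM; apply: addspan_gen.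
exists (lim (mon c (s1 ++ s2))), (lim (mon 1 s3)); split=> //.
  by apply: addspan_gen; exists (sdeg (s1 ++ s2)); apply/U_deg_limC/monomial_deg.
by apply: addspan_gen; exists (sdeg s3) => //; apply/U_deg_limC/monomial_deg.
Qed.

Lemma high_rep m r : (m <= d)%N -> addspan high_words r -> repn m r = 0.
Proof.
move=> md hr; apply: rep_act0 => f hf; move: r hr.
apply: addspan_min => [|x y hx hy|_ [c [s1 [s2 [s3 [h3 e3 e ->]]]]]].
- exact: act0.
- by rewrite actD hx hy; apply: funext => b; rewrite addr0.
rewrite act_monomial 2!act_cat; apply: funext => b.
have /fock_deg_neg -> : fock_deg (m%:Z + sdeg s3) (act (mon 1 s3) f).
- by apply: act_deg hf; apply: monomial_deg.
- by rewrite !act_fun0 mulr0.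
by lia.
Qed.

(** The component m + 1 suffices, since [L m.+1] kills the part of degree m; by [rhoE] any later
    component gives the same matrix. *)
Definition rho m (x : U) : mat m := repn m (lrep (x m.+1)).

Lemma rhoE m N (x : U) w : (m < N)%N -> x N = lpi L N w -> rho m x = repn m w.
Proof.
move=> mN xw; apply/eqP; rewrite -subr_eq0 -raddfB; apply/eqP.
apply: rep_act0 => f hf; apply: (act_filt (N := m.+1) _ hf); last by rewrite ltz_nat.
by rewrite -lpi_eq lrepK (comp_le mN xw).
Qed.

Lemma rho_is_zmod_morphism m : zmod_morphism (rho m).
Proof.
move=> x y; have [a xa] := invlim_rep x m.+1; have [b yb] := invlim_rep y m.+1.
have xyab : (x - y) m.+1 = lpi L m.+1 (a - b) by rewrite lpiB -xa -yb.
by rewrite (rhoE (ltnSn m) xyab) (rhoE (ltnSn m) xa) (rhoE (ltnSn m) yb) raddfB.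
Qed.
HB.instance Definition _ m := GRing.isZmodMorphism.Build U (mat m) (rho m)
  (rho_is_zmod_morphism m).

Lemma rho_lim m w : rho m (lim w) = repn m w.
Proof. exact: (@rhoE m m.+1). Qed.

Lemma rhoM m (x y : U) : U_deg G 0 y -> rho m (x * y) = rho m x *m rho m y.
Proof.
move=> hy; have [b hb yb] := hy m.+1; have [M0 gb0] := good_ex L m.+1 b.
have gb : good L (maxn M0 m.+1) m.+1 b by apply: good_le gb0; rewrite ?leq_maxl.
have [a xa] := invlim_rep x (maxn M0 m.+1).
have xy : (x * y) m.+1 = lpi L m.+1 (a * b) by apply: lim_mul_seqE gb.
rewrite (rhoE (ltnSn m) xy) (rhoE (ltnSn m) yb) (rhoE (leq_maxr _ _) xa).
exact: rep_mul.
Qed.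

Lemma rho1 m : rho m 1 = 1%:M.
Proof. by rewrite -[1]/(lim 1) rho_lim rep1. Qed.

(** The right factor of each product is a sum of elements of degree <= - d - 1, and these send
    degree m <= d to negative degree, that is, to 0. *)
Lemma rho_level m (x : U) : (m <= d)%N -> level x -> rho m x = 0.
Proof.
move=> md; move: x; apply: addspan_min => [|x y hx hy|_ [a [b [_ hb ->]]]].
- exact: raddf0.
- by rewrite raddfD /= hx hy addr0.
have [w bw kw] : exists2 w, b m.+1 = lpi L m.+1 w &
    forall f, fock_deg m%:Z f -> act w f = (fun=> 0).
  move: b hb; apply: addspan_min => [|x y [v xv kv] [w yw kw]|x [k kd hx]].
  - by exists 0 => [|f _]; rewrite ?comp0 ?lpi0 ?act0.
  - exists (v + w) => [|f hf]; first by rewrite compD xv yw lpiD.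
    by rewrite actD kv // kw //; apply: funext => c; rewrite addr0.
  have [w hw xw] := hx m.+1; exists w => // f hf.
  by apply: fock_deg_neg (act_deg hw hf); lia.
have [M0 gb0] := good_ex L m.+1 w; have [v av] := invlim_rep a M0.
have abv : (a * b) m.+1 = lpi L m.+1 (v * w) by apply: lim_mul_seqE gb0.
rewrite (rhoE (ltnSn m) abv); apply: rep_act0 => f hf.
by rewrite actM (kw f hf); exact: act_fun0.
Qed.

(** The blocks above m act as 0 in degree m by triangularity, and those below m are 0 by
    hypothesis. *)
Lemma rho_sum_block m k (v : nat -> W) : (forall i, block i (v i)) ->
  (m < k)%N -> (forall i, (i < m)%N -> v i = 0) -> repn m (\sum_(i < k) v i) = repn m (v m).
Proof.
move=> hv mk v0; rewrite raddf_sum (bigD1 (Ordinal mk)) //= big1 ?addr0 // => i.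
rewrite -val_eqE /= => im; have [ilm|mli|ei] := ltngtP (i : nat) m.
- by rewrite v0 // raddf0.
- by apply: rep_act0 => f hf; apply: block_act (hv i) mli hf.
by rewrite ei eqxx in im.
Qed.

Lemma rho_ker (x : U) : U_deg G 0 x -> (forall m, (m <= d)%N -> rho m x = 0) -> level x.
Proof.
move=> hx x0.
have /boolp.choice [w0 hw0] N : exists w, G 0 w /\ x N = lpi L N w.
  by have [w hw xw] := hx N; exists w.
(* All representatives are taken at a component >= d + 1. Thus [w 0] acts as [x] in degrees <= d,
   and the differences with N <= d vanish; the others only involve final modes H_i t^a with a >= d +
   1, as [small_mode] asks for k = d + 1. *)
pose w N := w0 (maxn N d.+1).
have wdeg N : G 0 (w N) by have [] := hw0 (maxn N d.+1).
have xw N : x N = lpi L N (w N).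
  by apply: (comp_le (leq_maxl N d.+1)); have [] := hw0 (maxn N d.+1).
have wL N : w N.+1 - w N \in L N.
  by rewrite -lpi_eq -xw -(comp_le (leqnSn N) (xw N.+1)).
have t0 N : lim (w N.+1 - w N) N = 0 by apply: lpi_eq0.
rewrite (lim_telescope t0 xw); apply: addspanD; last first.
  apply: (lim_sum_level (@rgenP R n d)).
    by move=> i; have := rgen_deg_ge i; lia.
  move=> N; have [Nd|dN] := ltnP N d.+1.
    rewrite /w (maxn_idPr Nd) (maxn_idPr (ltnW Nd)) subrr.
    exact: small_span0.
  have : G 0 (w N.+1 - w N) by apply: gr_degD (gr_degN _) => //; apply: wdeg.
  move/filt_deg => /(_ N (wL N)); move: (w N.+1 - w N); apply: addspan_min => [|y z|].
  - exact: small_span0.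
  - by rewrite limCD; apply: small_spanD.
  move=> _ [i [a [v [Na hv ->]]]]; apply: small_mode => //; last by rewrite -[a]add0r.
  by apply: le_trans Na; rewrite lez_nat.
(* What is left is the finite term [w 0]. Its blocks vanish one after the other, by induction on m:
   once the lower ones are 0, the matrix in degree m is that of the block m, and it determines this
   block. *)
have [v [r [hv hr ew]]] := normal_split (wdeg 0%N).
suff v0 m : (m <= d)%N -> v m = 0.
  rewrite ew big1 ?add0r; first exact: high_level.
  by move=> i _; apply: v0; rewrite -ltnS.
elim/ltn_ind: m => m IHm md; rewrite -(rep_blockK (hv m)).
suff -> : repn m (v m) = 0 by rewrite raddf0.
rewrite -(@rho_sum_block m d.+1) // => [|i im]; last by apply: IHm => //; lia.
have := x0 m md; rewrite (@rhoE m d.+1 x (w 0%N)) //; last first.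
  by have [] := hw0 (maxn 0 d.+1); rewrite /w max0n.
by rewrite ew raddfD /= (high_rep md hr) addr0.
Qed.

(** The matrices are prescribed by increasing degree: the error in degree k is corrected by a lift
    in the block k, which kills the lower degrees and so leaves the matrices already obtained
    unchanged. *)
Lemma rho_surj (P : forall m : 'I_d.+1, mat m) k : (k <= d.+1)%N ->
  exists2 w, G 0 w & forall m : 'I_d.+1, (m < k)%N -> repn m w = P m.
Proof.
elim: k => [_|k IHk kd]; first by exists 0 => //; apply: gr_deg0.
have [w hw ew] := IHk (ltnW kd); pose o := Ordinal kd.
exists (w + lift_mx (P o - repn o w)).
  by apply: gr_degD hw _; apply/block_deg/lift_mx_block.
move=> m; rewrite ltnS leq_eqVlt => /orP[/eqP mk|mk].
  have -> : m = o by apply: val_inj.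
  by rewrite raddfD /= lift_mxK addrC subrK.
rewrite raddfD /= ew //; apply/eqP; rewrite -subr_eq0 addrAC subrr add0r; apply/eqP.
by apply: rep_act0 => f hf; apply: block_act (lift_mx_block _) mk hf.
Qed.

Local Notation Prod := (prod_ring (fun m : 'I_d.+1 => mat m)).

Local Notation zpi := (tspi (TwoSided.clone (U0 L G) (@level_ideal W L G d) _)).

Definition zhu_fun (q : zhu R n d) : Prod :=
  fun m => rho m (U0_val (projT1 (cid (tspiP q)))).

Lemma zhu_funE (x : U0 L G) m : zhu_fun (zpi x) m = rho m (U0_val x).
Proof.
rewrite /zhu_fun; case: cid => y /= /eqP; rewrite tspi_eq => /asboolP h.
apply/eqP; rewrite -subr_eq0 -raddfB -oppr_eq0 -raddfN opprB; apply/eqP.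
by apply: rho_level h; rewrite -ltnS.
Qed.

Lemma zhu_fun_is_zmod_morphism : zmod_morphism zhu_fun.
Proof.
move=> p q; have [x ->] := tspiP p; have [y ->] := tspiP q.
apply: functional_extensionality_dep => m.
rewrite -[RHS]/(zhu_fun (zpi x) m - zhu_fun (zpi y) m) !zhu_funE.
rewrite -(raddfB zpi x y) -[LHS]/(zhu_fun (zpi (x - y)) m) zhu_funE.
exact: (raddfB (rho m)).
Qed.

Lemma zhu_fun_is_monoid_morphism : monoid_morphism zhu_fun.
Proof.
split=> [|p q]; apply: functional_extensionality_dep => m.
  by rewrite -[1 in LHS]/(zpi 1) zhu_funE; apply: rho1.
have [x ->] := tspiP p; have [y ->] := tspiP q.
transitivity (zhu_fun (zpi (x * y)) m); first by rewrite rmorphM.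
transitivity (zhu_fun (zpi x) m *m zhu_fun (zpi y) m); last by [].
by rewrite !zhu_funE; apply: rhoM; exact/asboolP/U0_valP.
Qed.

HB.instance Definition _ := GRing.isZmodMorphism.Build (zhu R n d) Prod zhu_fun
  zhu_fun_is_zmod_morphism.
HB.instance Definition _ := GRing.isMonoidMorphism.Build (zhu R n d) Prod zhu_fun
  zhu_fun_is_monoid_morphism.

Lemma zhu_fun_inj : injective zhu_fun.
Proof.
apply: raddf_inj => q; have [x ->] := tspiP q => x0.
apply/eqP; rewrite -(raddf0 zpi) tspi_eq subr0; apply/asboolP/rho_ker.
  exact/asboolP/U0_valP.
move=> m md; pose o : 'I_d.+1 := Ordinal (md : (m < d.+1)%N).
transitivity (zhu_fun (zpi x) o); first by rewrite zhu_funE.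
by have -> : zhu_fun (zpi x) = 0 by exact: x0.
Qed.

Lemma zhu_fun_surj (P : Prod) : exists q, zhu_fun q = P.
Proof.
have [w hw ew] := rho_surj P (leqnn d.+1).
have hU : U0_pred G (lim w) by apply/asboolP/U_deg_limC.
exists (zpi (MkU0 hU)); apply: functional_extensionality_dep => m.
by rewrite zhu_funE rho_lim ew.
Qed.

End LevelQuotient.

End Level.
Import Level.

Theorem theorem6p1p1 (R : realType) (n : nat) (hn : (1 <= n)%N) (d : nat) :
  exists f : {rmorphism zhu R n d ->
      prod_ring (fun m : 'I_d.+1 =>
        'M[{mpoly R[i][n]}]_(num_labeled_partitions n m))},
    bijective f.
Proof.
exists (GRing.RMorphism.clone _ _ (@zhu_fun R n d) _).
have /boolp.choice [g gK] := @zhu_fun_surj R n d.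
by exists g => // q; apply: (@zhu_fun_inj R n d); rewrite gK.
Qed.
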